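(* Let $\kappa$ be a measurable cardinal, let $A_1=\{\alpha<\kappa:\alpha\text{ is a compact cardinal}\}$ and $A_2=\{\alpha<\kappa:\alpha\text{ is a supercompact cardinal}\}$, and let $V$ be a normal ultrafilter on $\kappa$ such that $A_2\in V$. Then there is another normal ultrafilter $W$ on $\kappa$ such that $A_1\in W$ but $A_2\notin W$.
   Context: Work in ZFC. A measurable cardinal is an uncountable cardinal $\kappa$ carrying a $\kappa$-complete non-principal ultrafilter. A normal ultrafilter on $\kappa$ is a $\kappa$-complete non-principal ultrafilter on $\kappa$ such that every regressive function on a set in the ultrafilter is constant on a set in the ultrafilter. An uncountable cardinal $\kappa$ is compact (i.e. strongly compact) if the infinitary language $\mathcal{L}_{\kappa\kappa}$ is compact: every set of $\mathcal{L}_{\kappa\kappa}$-sentences (in any signature) all of whose subsets of cardinality less than $\kappa$ have models, has a model. A cardinal $\kappa$ is $\gamma$-supercompact if there is an elementary embedding $\jmath$ of the universe into a transitive class $M$ with critical point $\kappa$ and ${}^\gamma M\subseteq M$ (for $\gamma\ge\kappa$, as usual, with $\jmath(\kappa)>\gamma$; equivalently there is a fine normal measure on $\mathcal{P}_\kappa\gamma$); $\kappa$ is supercompact if it is $\gamma$-supercompact for every $\gamma$. *)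

(* Defs.v *)
From mathcomp Require Import all_boot.
From mathcomp Require Import boolp classical_sets functions cardinality filter.

Set Implicit Arguments.
Unset Strict Implicit.
Unset Printing Implicit Defensive.

Local Open Scope classical_set_scope.
Local Open Scope card_scope.

(* Sets are the elements of a universe of ZFC and classes are the Rocq
   predicates on it: the schema of replacement ranges over all functional
   relations, so a class included in a set is a set, and a Rocq function defined
   on a set is a set.  [elts a] is the class of the members of [a]. *)
Record zfc_universe := ZFCUniverse {
  zset :> Type;
  elts : zset -> set zset;
  zfc_extensionality : forall a b, elts a = elts b -> a = b;
  zfc_foundation : forall a, elts a !=set0 ->
    exists2 b, elts a b & elts b `&` elts a = set0;
  zfc_pairing : forall a b, exists c, elts c = [set a; b];
  zfc_union : forall a, exists c, elts c = \bigcup_(b in elts a) elts b;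
  zfc_power : forall a, exists c, elts c = [set b | elts b `<=` elts a];
  zfc_infinity : exists a,
    (exists2 e, elts a e & elts e = set0) /\
    (forall x, elts a x -> exists2 y, elts a y & elts y = elts x `|` [set x]);
  zfc_replacement : forall (R : zset -> zset -> Prop) a,
    (forall x y y', elts a x -> R x y -> R x y' -> y = y') ->
    exists b, elts b = [set y | exists2 x, elts a x & R x y];
  zfc_choice : forall a,
    (forall x, elts a x -> elts x !=set0) ->
    (forall x y, elts a x -> elts a y -> elts x `&` elts y !=set0 -> x = y) ->
    exists c, forall x, elts a x -> exists z, elts x `&` elts c = [set z]
}.

(* With this coercion and [set_type], a set [a : Z] is also the type of its
   members. *)
Coercion elts : zset >-> set.

Notation "x ∈ a" := (elts a x) (at level 70, no associativity).

Section Cardinals.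
Variable Z : zfc_universe.
Implicit Types (x y a κ : Z).

Definition transitive_set a := forall x, x ∈ a -> elts x `<=` elts a.

Definition is_ordinal a :=
  transitive_set a /\ forall x, x ∈ a -> transitive_set x.

Definition is_cardinal κ :=
  is_ordinal κ /\ forall ξ, ξ ∈ κ -> ~ (elts ξ #= elts κ).

Definition is_uncountable_cardinal κ := is_cardinal κ /\ ~ countable (elts κ).

Definition is_small T (A : set T) := exists a, A #= elts a.

(* For a cardinal κ this is |A| < κ. *)
Definition card_lt T (A : set T) κ := exists2 ξ, ξ ∈ κ & A #= elts ξ.

Definition kpair p x y :=
  exists a b, [/\ elts a = [set x], elts b = [set x; y] & elts p = [set a; b]].

End Cardinals.

Section Ultrafilters.
Variables (Z : zfc_universe) (κ : Z).

Definition complete_filter (U : set_system κ) :=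
  forall A : set_system κ, A `<=` U -> card_lt A κ -> U (\bigcap_(X in A) X).

Definition nonprincipal (U : set_system κ) :=
  forall x : κ, U <> principal_filter x.

Definition complete_nonprincipal_ultrafilter (U : set_system κ) :=
  [/\ UltraFilter U, complete_filter U & nonprincipal U].

Definition measurable_cardinal :=
  is_uncountable_cardinal κ /\ exists U, complete_nonprincipal_ultrafilter U.

Definition normal_ultrafilter (U : set_system κ) :=
  complete_nonprincipal_ultrafilter U /\
  forall (X : set κ) (f : κ -> κ), U X ->
    (forall α, X α -> val (f α) ∈ val α) ->
    exists2 Y, U Y & Y `<=` X /\ exists β, forall α, Y α -> f α = β.

End Ultrafilters.

Section Infinitary.
Variable Z : zfc_universe.

Record signature := Signature {
  fun_sym : Z;
  fun_arity : fun_sym -> nat;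
  rel_sym : Z;
  rel_arity : rel_sym -> nat
}.

(* The language L_κκ over S, with a variable for each member of κ: besides the
   first-order finitary terms and atoms, it has conjunctions and universal
   quantifications over sequences of length less than κ. *)
Inductive term (κ : Z) (S : signature) : Type :=
| Var (x : κ)
| App (f : fun_sym S) (t : 'I_(fun_arity f) -> term κ S).

Inductive formula (κ : Z) (S : signature) : Type :=
| Equal (t u : term κ S)
| Rel (r : rel_sym S) (t : 'I_(rel_arity r) -> term κ S)
| Neg (φ : formula κ S)
| Conj (ξ : κ) (Φ : val ξ -> formula κ S)
| Forall (ξ : κ) (x : val ξ -> κ) (φ : formula κ S).

Section Syntax.
Variables (κ : Z) (S : signature).

Fixpoint var_in_term (t : term κ S) (v : κ) : Prop :=
  match t with
  | Var x => x = v
  | App f t => exists i, var_in_term (t i) v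
  end.

Fixpoint free_in (φ : formula κ S) (v : κ) : Prop :=
  match φ with
  | Equal t u => var_in_term t v \/ var_in_term u v
  | Rel r t => exists i, var_in_term (t i) v
  | Neg φ => free_in φ v
  | Conj ξ Φ => exists η, free_in (Φ η) v
  | Forall ξ x φ => free_in φ v /\ forall η, x η <> v
  end.

Definition sentence (φ : formula κ S) := forall v, ~ free_in φ v.

Record structure := Structure {
  carrier : Z;
  carrier_nonempty : elts carrier !=set0;
  fun_interp : forall f : fun_sym S,
    ('I_(fun_arity f) -> carrier) -> carrier;
  rel_interp : forall r : rel_sym S, ('I_(rel_arity r) -> carrier) -> Prop
}.

Variable D : structure.

Fixpoint eval (s : κ -> carrier D) (t : term κ S) : carrier D :=
  match t with
  | Var x => s x
  | App f t => fun_interp (fun i => eval s (t i))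
  end.

Fixpoint satisfies (s : κ -> carrier D) (φ : formula κ S) : Prop :=
  match φ with
  | Equal t u => eval s t = eval s u
  | Rel r t => rel_interp (fun i => eval s (t i))
  | Neg φ => ~ satisfies s φ
  | Conj ξ Φ => forall η, satisfies s (Φ η)
  | Forall ξ x φ => forall s' : κ -> carrier D,
      (forall v, (forall η, x η <> v) -> s' v = s v) -> satisfies s' φ
  end.

End Syntax.

Definition has_model (κ : Z) (S : signature) (Σ : set (formula κ S)) :=
  exists D : structure S, forall φ, Σ φ ->
    forall s : κ -> carrier D, satisfies s φ.

Definition compact_cardinal (κ : Z) :=
  is_uncountable_cardinal κ /\
  forall (S : signature) (Σ : set (formula κ S)),
    is_small Z Σ -> (forall φ, Σ φ -> sentence φ) ->
    (forall Σ0, Σ0 `<=` Σ -> card_lt Σ0 κ -> has_model Σ0) ->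
    has_model Σ.

End Infinitary.

(* First-order formulas of set theory; variables are de Bruijn indices. *)
Inductive st_formula : Type :=
| StMem (i j : nat)
| StEq (i j : nat)
| StNeg (φ : st_formula)
| StAnd (φ ψ : st_formula)
| StAll (φ : st_formula).

Section Supercompact.
Variable Z : zfc_universe.

Definition env_cons (x : Z) (e : nat -> Z) (n : nat) : Z :=
  if n is m.+1 then e m else x.

(* Truth of [φ] in the class [M]. *)
Fixpoint st_satisfies (M : set Z) (e : nat -> Z) (φ : st_formula) : Prop :=
  match φ with
  | StMem i j => e i ∈ e j
  | StEq i j => e i = e j
  | StNeg φ => ~ st_satisfies M e φ
  | StAnd φ ψ => st_satisfies M e φ /\ st_satisfies M e ψ
  | StAll φ => forall x, M x -> st_satisfies M (env_cons x e) φ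
  end.

Definition transitive_class (M : set Z) := forall x, M x -> elts x `<=` M.

Definition elementary_embedding (M : set Z) (j : Z -> Z) :=
  (forall x, M (j x)) /\
  forall φ e, st_satisfies setT e φ <-> st_satisfies M (j \o e) φ.

Definition critical_point (j : Z -> Z) (κ : Z) :=
  [/\ is_ordinal κ, j κ <> κ & forall ξ, ξ ∈ κ -> j ξ = ξ].

(* The function [f] with domain γ belongs to [M] as the set of its ordered
   pairs. *)
Definition closed_under_sequences (M : set Z) (γ : Z) :=
  forall f : γ -> Z, (forall ξ, M (f ξ)) ->
  forall g : Z, elts g = [set p | exists ξ : γ, kpair p (val ξ) (f ξ)] -> M g.

Definition supercompact_upto (κ γ : Z) :=
  is_cardinal κ /\
  exists (M : set Z) (j : Z -> Z),
    [/\ transitive_class M, elementary_embedding M j, critical_point j κ,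
        closed_under_sequences M γ &
        elts κ `<=` elts γ -> γ ∈ j κ].

Definition supercompact_cardinal (κ : Z) :=
  forall γ : Z, is_ordinal γ -> supercompact_upto κ γ.

End Supercompact.

(* Main.v *)
Require Import Defs.
From mathcomp Require Import all_boot.
From mathcomp Require Import boolp classical_sets functions cardinality filter.

Set Implicit Arguments.
Unset Strict Implicit.
Unset Printing Implicit Defensive.

Local Open Scope classical_set_scope.
Local Open Scope card_scope.

(** The informal argument takes, among the normal ultrafilters on [κ] that contain
    the set of compact cardinals, one which is minimal in the Mitchell order: were
    it to contain the set of supercompact cardinals, [κ] would be supercompact in
    its ultrapower, and a normal ultrafilter below it would still contain the set
    of compact cardinals. Here the same idea is run as an induction on [κ]
    (normal_avoiding_supercompact). Suppose that [V] is normal on [κ] and contains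
    both sets. Almost every [α] below [κ] is then supercompact and a limit of
    compact cardinals, so it carries a normal ultrafilter containing the set of
    compact cardinals (supercompact_normal), and by induction one, [U α], that
    moreover omits the set of supercompact cardinals. The sets whose trace on
    almost every [α] is in [U α] form the required ultrafilter on [κ]
    (normal_average).

    To produce the first ultrafilter on a supercompact [κ] that is a limit of
    compact cardinals, let [j] be an embedding into a class [M] that is closed
    under sequences of length 2^κ, and let [U] be the family of the
    subsets [X] of [κ] such that [κ] belongs to [j X]. It is normal and it belongs
    to [M], where [κ] is thus measurable and still a limit of the compact cardinals
    below [κ]. By reflection, almost every ordinal below [κ] is measurable and a
    limit of compact cardinals, and such cardinals are compact by a theorem of
    Menas (measurable_limit_compact).

    Compactness of an infinitary language only enters through an equivalent
    extension property (ultrafilter_extension): a family of subsets of a set all of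
    whose small subfamilies have a common point extends to a complete ultrafilter.
    A compact cardinal has it because a propositional theory can describe the
    ultrafilter (compact_extension); conversely it gives models as ultraproducts,
    by Łoś's theorem for the infinitary language (satisfies_ultraproduct and
    extension_compact). Menas's theorem is then an averaging of ultrafilters, and
    a supercompact cardinal is compact because the pointwise image under [j] of
    the given family has a common point in [M] (supercompact_extension). *)

(** * Sets of a universe *)

Section Universe.
Variable Z : zfc_universe.
Implicit Types (a b c x y z p : Z) (A B : set Z).

Definition setlike A := exists a, elts a = A.

Lemma setlike_replace (R : Z -> Z -> Prop) a :
  (forall x y y', x ∈ a -> R x y -> R x y' -> y = y') ->
  setlike [set y | exists2 x, x ∈ a & R x y].
Proof. by move=> /zfc_replacement. Qed.

Lemma setlike_sub A a : A `<=` elts a -> setlike A.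
Proof.
move=> Aa; have [|b bE] := @setlike_replace (fun x y => x = y /\ A y) a.
  by move=> x y y' _ [<- _] [<- _].
exists b; rewrite bE eqEsubset; split => [y [x _ [_]]|y Ay]//.
by exists y => //; exact: Aa.
Qed.

Lemma zempty_exists : exists e : Z, elts e = set0.
Proof.
have [a _] := zfc_infinity Z.
exact: (@setlike_sub set0 a).
Qed.

Definition zempty : Z := projT1 (cid zempty_exists).

Lemma zemptyE : elts zempty = set0.
Proof. exact: projT2 (cid zempty_exists). Qed.

Definition zset_of A : Z :=
  if pselect (setlike A) is left h then projT1 (cid h) else zempty.

Lemma zset_ofE A : setlike A -> elts (zset_of A) = A.
Proof. by rewrite /zset_of; case: pselect => // h _; case: (cid h). Qed.

Lemma setlike_range a (f : a -> Z) : setlike (range f).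
Proof.
have [|b bE] := @setlike_replace (fun x y => exists u : a, val u = x /\ f u = y) a.
  by move=> x y y' _ [u [<- <-]] [v [/val_inj -> <-]].
exists b; rewrite bE eqEsubset; split => [y [x _ [u [_ <-]]]|y [u _ <-]]; first by exists u.
by exists (val u); [exact: set_valP|exists u].
Qed.

Lemma setlike_image a (f : Z -> Z) : setlike (f @` elts a).
Proof.
have [|b bE] := @setlike_replace (fun x y => f x = y) a.
  by move=> x y y' _ <-.
by exists b; rewrite bE.
Qed.

Lemma setlike_pow a : setlike [set b | elts b `<=` elts a].
Proof. exact: zfc_power. Qed.

Lemma setlike_bigcup a (f : Z -> Z) : setlike (\bigcup_(x in elts a) elts (f x)).
Proof.
have [b bE] := setlike_image a f; have [c cE] := zfc_union b.
by exists c; rewrite cE bE bigcup_image.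
Qed.

Lemma setlikeU a b : setlike (elts a `|` elts b).
Proof.
have [c cE] := zfc_pairing a b; have [d dE] := zfc_union c.
exists d; rewrite dE cE eqEsubset; split=> [x [y [->|->]]|x [xa|xb]]; [by left|by right| |].
  by exists a => //; left.
by exists b => //; right.
Qed.

Definition upair a b := zset_of [set a; b].

Lemma upairE a b : elts (upair a b) = [set a; b].
Proof. by rewrite zset_ofE//; exact: zfc_pairing. Qed.

Definition opair x y := upair (upair x x) (upair x y).

Lemma kpairP p x y : kpair p x y <-> p = opair x y.
Proof.
split=> [[a [b [aE bE pE]]]|->].
  apply: zfc_extensionality; rewrite pE upairE.
  have -> : a = upair x x by apply: zfc_extensionality; rewrite upairE setUid.
  by have -> : b = upair x y by apply: zfc_extensionality; rewrite upairE.
by exists (upair x x), (upair x y); split; rewrite upairE// setUid.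
Qed.

Lemma upair_inj x y y' : upair x y = upair x y' -> y = y'.
Proof.
move=> /(congr1 (@elts Z)); rewrite !upairE => e.
have : [set x; y'] y by rewrite -e; right.
have : [set x; y] y' by rewrite e; right.
by move=> [->|->] // [] ->.
Qed.

Lemma opair_inj x y x' y' : opair x y = opair x' y' -> x = x' /\ y = y'.
Proof.
move=> e.
have xx' : x = x'.
  have : elts (opair x y) (upair x x) by rewrite upairE; left.
  have x'2 w : elts (upair x' w) x' by rewrite upairE; left.
  rewrite e upairE => -[] h.
    by have := x'2 x'; rewrite -h upairE => -[].
  by have := x'2 y'; rewrite -h upairE => -[].
split=> //; subst x'.
exact: upair_inj (upair_inj e).
Qed.

Definition zprod a b := zset_of [set p | exists x y, [/\ x ∈ a, y ∈ b & p = opair x y]].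

Lemma zprodE a b :
  elts (zprod a b) = [set p | exists x y, [/\ x ∈ a, y ∈ b & p = opair x y]].
Proof.
rewrite zset_ofE//.
pose f x := zset_of (opair x @` elts b).
have [c cE] := setlike_bigcup a f; exists c.
have fE x : elts (f x) = opair x @` elts b by rewrite zset_ofE//; exact: setlike_image.
rewrite cE eqEsubset; split => [p [x xa]|p [x [y [xa yb ->]]]].
  by rewrite fE => -[y yb <-]; exists x, y.
by exists x => //; rewrite fE; exists y.
Qed.

Definition zpow a := zset_of [set b | elts b `<=` elts a].

Lemma zpowE a : elts (zpow a) = [set b | elts b `<=` elts a].
Proof. by rewrite zset_ofE//; exact: setlike_pow. Qed.

(** Embeddings act on the members of the universe, whereas ultrafilters are made
    of predicates on the type of members of [a]: this goes from the latter to the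
    former. *)
Definition sub_of a (X : set a) : Z := zset_of (val @` X).

Lemma sub_ofE a (X : set a) : elts (sub_of X) = val @` X.
Proof.
rewrite zset_ofE//; apply: (@setlike_sub _ a) => _ [x _ <-]; exact: set_valP.
Qed.

Lemma sub_of_val a (X : set a) (x : a) : elts (sub_of X) (val x) <-> X x.
Proof.
rewrite sub_ofE; split=> [[y Xy /val_inj <-]//|Xx]; by exists x.
Qed.

Lemma sub_of_sub a (X : set a) : elts (sub_of X) `<=` elts a.
Proof. rewrite sub_ofE => _ [x _ <-]; exact: set_valP. Qed.

Lemma sub_of_pow a (X : set a) : sub_of X ∈ zpow a.
Proof. by rewrite zpowE; exact: sub_of_sub. Qed.

Definition fun_graph a (f : a -> Z) : Z :=
  zset_of (range (fun u => opair (val u) (f u))).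

Lemma fun_graphE a (f : a -> Z) :
  elts (fun_graph f) = range (fun u => opair (val u) (f u)).
Proof. by rewrite zset_ofE//; exact: setlike_range. Qed.

(** A family of subsets of [b] is coded by the relation whose fibers are its
    members; fibers are easier to describe in the language of set theory than
    the values of a function. *)
Definition family_graph a b (X : a -> set b) : Z :=
  zset_of [set p | exists u v, p = opair (val u) (val v) /\ X u v].

Lemma family_graphE a b (X : a -> set b) : elts (family_graph X) =
  [set p | exists u v, p = opair (val u) (val v) /\ X u v].
Proof.
rewrite zset_ofE//; apply: (@setlike_sub _ (zprod a b)) => _ [u [v [-> _]]].
by rewrite zprodE; exists (val u), (val v); split=> //; exact: set_valP.
Qed.

Lemma family_graph_pow a b c (X : a -> set b) : elts a `<=` elts c ->
  family_graph X ∈ zpow (zprod c b).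
Proof.
move=> ac; rewrite zpowE /= family_graphE => _ [u [v [-> _]]]; rewrite zprodE.
exists (val u), (val v); split=> //; last exact: set_valP.
by apply: ac; exact: set_valP.
Qed.

Lemma mem_family_graph a b (X : a -> set b) u v :
  opair (val u) (val v) ∈ family_graph X <-> X u v.
Proof.
rewrite family_graphE; split=> [[u' [v' [/opair_inj[/val_inj -> /val_inj ->]]]]//|Xuv].
by exists u, v.
Qed.

Definition mem_of a x (xa : x ∈ a) : a := SigSub (mem_set xa).

Lemma mem_elim x a : x ∈ a -> exists u : a, val u = x.
Proof. by move=> xa; exists (mem_of xa). Qed.

Lemma mem_irr x : ~ x ∈ x.
Proof.
move=> xx; have xE : elts (upair x x) = [set x] by rewrite upairE setUid.
have [|y] := @zfc_foundation Z (upair x x); first by exists x; rewrite xE.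
rewrite xE => -> h; have : (elts x `&` [set x]) x by [].
by rewrite h.
Qed.

Lemma family_graph_fiber a b (X : a -> set b) u z : z ∈ sub_of (X u) ->
  exists2 p, p ∈ family_graph X & p = opair (val u) z.
Proof.
rewrite sub_ofE => -[v Xv <-]; exists (opair (val u) (val v)) => //.
exact/mem_family_graph.
Qed.

Lemma family_graph_meet a b (X : a -> set b) (v : b) :
  (forall y, y ∈ a -> exists2 p, p ∈ family_graph X & p = opair y (val v)) ->
  forall u, X u v.
Proof.
move=> h u; have [p pg pE] := h _ (set_valP u).
by apply/mem_family_graph; rewrite -pE.
Qed.

(** A descending sequence would have a range without minimal member; that
    range is a set because the von Neumann numerals lie in one. *)
Lemma mem_wf : well_founded (fun x y : Z => x ∈ y).
Proof.
move=> x0; apply: contrapT => nacc.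
have step x : ~ Acc (fun x y : Z => x ∈ y) x ->
    exists y, y ∈ x /\ ~ Acc (fun x y : Z => x ∈ y) y.
  move=> nx; apply: contrapT => h; apply: nx; constructor => y yx.
  by apply: contrapT => ny; apply: h; exists y.
pose T := {x : Z | ~ Acc (fun x y : Z => x ∈ y) x}.
pose next (t : T) : T := let: exist x h := t in
  let: exist y hy := cid (step x h) in exist _ y hy.2.
have nextP t : sval (next t) ∈ sval t.
  by case: t => x h /=; case: (cid _) => y [].
pose f n := sval (iter n next (exist _ x0 nacc)).
have fS n : f n.+1 ∈ f n by exact: nextP.
have [w [[e we eE] wS]] := zfc_infinity Z.
have /choice[s sP] x : exists y, x ∈ w -> y ∈ w /\ elts y = elts x `|` [set x].
  by have [/wS[y]|] := pselect (x ∈ w); [exists y|exists x].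
pose c n := iter n s e.
have cw n : c n ∈ w by elim: n => //= n /sP[].
have cS n : elts (c n.+1) = elts (c n) `|` [set c n] by have /sP[] := cw n.
have clt n k : c n ∈ c (k + n.+1)%N.
  elim: k => [|k IH]; rewrite ?addSn cS; [by right|by left].
have cI n m : c n = c m -> n = m.
  move=> cnm; case: (ltngtP n m) => // h.
    have := clt n (m - n.+1)%N; rewrite subnK// -cnm => /mem_irr[].
  have := clt m (n - m.+1)%N; rewrite subnK// cnm => /mem_irr[].
have [|r rE] := @setlike_replace (fun x y => exists n, x = c n /\ y = f n) w.
  by move=> x y y' _ [n [-> ->]] [m [/cI -> ->]].
have fr n : f n ∈ r by rewrite rE; exists (c n) => //; exists n.
have [|b] := @zfc_foundation Z r; first by exists (f 0); exact: fr.
rewrite {1}rE => -[_ _ [n [_ ->]]] h.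
have : (elts (f n) `&` elts r) (f n.+1) by split.
by rewrite h.
Qed.

Lemma mem_ind (P : Z -> Prop) :
  (forall x, (forall y, y ∈ x -> P y) -> P x) -> forall x, P x.
Proof. by move=> h x; elim: (mem_wf x) => {}x _; exact: h. Qed.

Lemma mem_asym x y : x ∈ y -> ~ y ∈ x.
Proof.
move=> xy; elim/mem_ind: x y xy => x IH y xy yx.
exact: (IH y yx x).
Qed.

Definition mem_rec (T : Type) (F : forall x : Z, (forall y, y ∈ x -> T) -> T) : Z -> T :=
  Fix mem_wf (fun _ => T) F.

Lemma mem_recE T (F : forall x : Z, (forall y, y ∈ x -> T) -> T) x :
  mem_rec F x = F x (fun y _ => mem_rec F y).
Proof.
apply: Fix_eq => {}x f g fg; congr F.
by apply: functional_extensionality_dep => y; apply: functional_extensionality_dep => h.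
Qed.

End Universe.

Definition choose_in T (d : T) (P : set T) : T :=
  if pselect (P !=set0) is left h then projT1 (cid h) else d.

Lemma choose_inP T (d : T) (P : set T) : P !=set0 -> P (choose_in d P).
Proof. by rewrite /choose_in; case: pselect => // h _; exact: projT2 (cid h). Qed.

Lemma choose_in_none T (d : T) (P : set T) : ~ (P !=set0) -> choose_in d P = d.
Proof. by rewrite /choose_in; case: pselect. Qed.

(** * Ordinals and small cardinalities *)

Section Ordinals.
Variable Z : zfc_universe.
Implicit Types (a b x y z α β γ κ ξ η : Z).

Lemma ordinal_mem α β : is_ordinal α -> β ∈ α -> is_ordinal β.
Proof.
move=> [ta oa] ba; split; first exact: oa.
by move=> x xb; apply: oa; exact: ta xb.
Qed.

Lemma ordinal_trans α β γ : is_ordinal γ -> α ∈ β -> β ∈ γ -> α ∈ γ.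
Proof. by move=> [tg _] ab bg; exact: tg ab. Qed.

Lemma ordinal_trichotomy α β : is_ordinal α -> is_ordinal β ->
  [\/ α ∈ β, α = β | β ∈ α].
Proof.
elim/mem_ind: α β => α IHa β oa; elim/mem_ind: β => β IHb ob.
have [|/existsNP[x /not_implyP[xa xnb]]] := pselect (elts α `<=` elts β).
  move=> ab; have [|/existsNP[y /not_implyP[yb yna]]] := pselect (elts β `<=` elts α).
    by move=> ba; apply: Or32; apply: zfc_extensionality; rewrite eqEsubset.
  have [ay|ay|//] := IHb _ yb (ordinal_mem ob yb); apply: Or31; last by rewrite ay.
  exact: (ordinal_trans ob ay yb).
have [//|bx|bx] := IHa _ xa _ (ordinal_mem oa xa) ob; apply: Or33; first by rewrite -bx.
exact: (ordinal_trans oa bx xa).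
Qed.

Lemma ordinal_sub α β : is_ordinal α -> is_ordinal β -> elts α `<=` elts β ->
  α = β \/ α ∈ β.
Proof.
move=> oa ob ab; have [||ba] := ordinal_trichotomy oa ob; [by right|by left|].
by case: (@mem_irr _ β); exact: ab.
Qed.

Lemma ordinalU α β : is_ordinal α -> is_ordinal β ->
  is_ordinal (zset_of (elts α `|` elts β)).
Proof.
move=> [ta oa] [tb ob]; rewrite /is_ordinal /transitive_set zset_ofE; last exact: setlikeU.
split=> x [xa|xb]; first by move=> y yx; left; exact: ta yx.
- by move=> y yx; right; exact: tb yx.
- exact: oa.
- exact: ob.
Qed.

Lemma not_setlike_ordinals : ~ setlike [set α : Z | is_ordinal α].
Proof.
move=> [o oE].
have oo : is_ordinal o.
  split=> x; rewrite oE => ox; last exact: ox.1.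
  by move=> y yx; apply: ordinal_mem yx.
by apply: (@mem_irr _ o); rewrite oE.
Qed.

(** Choosing new members of [b] along the ordinals must exhaust [b], since
    otherwise replacement would make a set of all the ordinals. *)
Lemma ordinal_surjection b α : elts b !=set0 -> is_ordinal α ->
  exists γ, [/\ is_ordinal γ, elts α `<=` elts γ &
    exists f : γ -> Z, range f = elts b].
Proof.
move=> b0 oa.
have [d bd] := b0.
pose new (A : set Z) := choose_in d (elts b `\` A).
pose F x (g : forall y, y ∈ x -> Z) := new [set z | exists y (yx : y ∈ x), g y yx = z].
pose G := mem_rec F.
have GE x : G x = new (G @` elts x).
  rewrite /G mem_recE /F; congr new; apply/seteqP; split => z.
    by move=> [y [yx <-]]; exists y.
  by move=> [y yx <-]; exists y, yx.
have Gb x : G x ∈ b.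
  rewrite GE /new; have [/(choose_inP d)[]//|/(choose_in_none d) -> //] :=
    pselect (elts b `\` G @` elts x !=set0).
have [γ [og bG]] : exists γ, is_ordinal γ /\ elts b `<=` G @` elts γ.
  apply: contrapT => h; apply: not_setlike_ordinals.
  have Gnew x : is_ordinal x -> ~ (G @` elts x) (G x).
    move=> ox; have /existsNP[z /not_implyP[bz nz]] : ~ (elts b `<=` G @` elts x).
      by move=> ?; apply: h; exists x.
    have nE : elts b `\` G @` elts x !=set0 by exists z.
    by have [_] := choose_inP d nE; rewrite -/(new _) -GE.
  have [|c cE] := @setlike_replace Z (fun x y => is_ordinal y /\ G y = x) b.
    move=> x y y' _ [oy <-] [oy' yy'].
    have [yy|//|yy] := ordinal_trichotomy oy oy'.
      by case: (Gnew _ oy'); exists y.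
    by case: (Gnew _ oy); exists y'.
  exists c; rewrite cE; apply/seteqP; split => [y [x _ []]//|y oy].
  by exists (G y).
pose δ := zset_of (elts γ `|` elts α).
have dE : elts δ = elts γ `|` elts α by rewrite zset_ofE//; exact: setlikeU.
exists δ; split; first exact: ordinalU.
  by rewrite dE; right.
exists (fun u : δ => G (val u)); apply/seteqP; split => [_ [x _ <-]//|y /bG[x xg <-]].
have xd : x ∈ δ by rewrite dE; left.
by exists (mem_of xd).
Qed.

(** The Mostowski collapse of [B], which does not move ordinals upwards. *)
Lemma ordinal_collapse ξ (B : set Z) : is_ordinal ξ -> B `<=` elts ξ ->
  exists η, [/\ is_ordinal η, elts η `<=` elts ξ & B #= elts η].
Proof.
move=> ox Bx.
pose F x (g : forall y, y ∈ x -> Z) :=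
  zset_of [set z | exists y (yx : y ∈ x), B y /\ g y yx = z].
pose π := mem_rec F.
have πE x : elts (π x) = π @` (elts x `&` B).
  have BE : [set z | exists y (yx : y ∈ x), B y /\ π y = z] = π @` (elts x `&` B).
    apply/seteqP; split => z; first by move=> [y [yx [By <-]]]; exists y.
    by move=> [y [yx By] <-]; exists y, yx.
  rewrite /π mem_recE /F -/π zset_ofE BE//.
  have [c cE] := setlike_image x π.
  by apply: (@setlike_sub _ _ c); rewrite cE => _ [y [yx _] <-]; exists y.
have πo x : is_ordinal x -> is_ordinal (π x) /\ elts (π x) `<=` elts x.
  elim/mem_ind: x => x IH xo.
  have sub : elts (π x) `<=` elts x.
    rewrite πE => _ [y [yx _] <-].
    have [o1 o2] := IH _ yx (ordinal_mem xo yx).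
    have [->//|h] := ordinal_sub o1 (ordinal_mem xo yx) o2.
    exact: (ordinal_trans xo h yx).
  split=> //; split=> y; last first.
    by rewrite πE => -[z [zx _] <-]; exact: (IH _ zx (ordinal_mem xo zx)).1.1.
  rewrite πE => -[z [zx Bz] <-] w.
  rewrite πE => -[v [vz Bv] <-]; exists v => //; split=> //.
  exact: (ordinal_trans xo vz zx).
exists (π ξ); split; [exact: (πo _ ox).1|exact: (πo _ ox).2|].
rewrite πE (_ : elts ξ `&` B = B); last by apply/setIidr.
rewrite card_eq_sym; apply: inj_card_eq => x y /set_mem Bx' /set_mem By' e.
have [xo yo] : is_ordinal x /\ is_ordinal y by split; exact/(ordinal_mem ox)/Bx.
have lt u v : B u -> u ∈ v -> π u = π v -> False.
  move=> Bu uv uvE; apply: (@mem_irr _ (π u)); rewrite {1}uvE πE; by exists u.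
have [xy|//|xy] := ordinal_trichotomy xo yo; first by case: (lt _ _ Bx' xy e).
by case: (lt _ _ By' xy (esym e)).
Qed.

Lemma card_lt_le T T' (A : set T) (B : set T') κ : is_ordinal κ ->
  card_lt B κ -> A #<= B -> card_lt A κ.
Proof.
move=> ok [ξ xk Bx] AB.
have : A #<= elts ξ by rewrite (card_le_trans AB)// (card_le_eql Bx).
have oxi := ordinal_mem ok xk.
move=> /card_subP[C AC Cx].
have [η [oh hx Ch]] := ordinal_collapse oxi Cx.
exists η; last by rewrite -(card_eql AC).
have [->//|h] := ordinal_sub oh oxi hx; exact: (ordinal_trans ok h xk).
Qed.

Lemma card_lt_range κ ξ T (f : ξ -> T) : is_ordinal κ -> ξ ∈ κ -> card_lt (range f) κ.
Proof.
move=> ok xk; apply: (@card_lt_le _ _ _ [set: ξ]) => //; last exact: card_image_le.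
by exists ξ => //; exact: card_setT.
Qed.

Lemma card_lt_enum T (A : set T) κ : card_lt A κ ->
  exists ξ (f : ξ -> T), ξ ∈ κ /\ range f = A.
Proof.
move=> [ξ xk] /card_bijP[f [g fK gK]]; exists ξ, (fun u => val (g u)); split=> //.
apply/seteqP; split => [_ [u _ <-]|x Ax]; first exact: set_valP.
by exists (f (SigSub (mem_set Ax))) => //; rewrite fK.
Qed.

End Ordinals.

(** * Complete ultrafilters *)

Section CompleteUltrafilters.
Variable Z : zfc_universe.
Implicit Types (κ ξ : Z).

(** Closure under supersets and under intersections of length less than [κ] are
    merged in one clause about sequences, which is the only one to check, besides
    complementation, for the many ultrafilters constructed below; when [κ] is an
    uncountable cardinal, it yields all the rest. *)
Definition ultra_complete κ T (U : set_system T) :=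
  (forall X, U (~` X) <-> ~ U X) /\
  forall ξ (X : ξ -> set T) Y, ξ ∈ κ -> (forall η, U (X η)) ->
    (forall t, (forall η, X η t) -> Y t) -> U Y.

(** A sequence length with two indices makes binary intersections and conjunctions
    special cases of those of length less than [κ]. *)
Definition has_pair κ := exists ξ, ξ ∈ κ /\ exists e0 e1 : ξ, e0 <> e1.

Lemma uncountable_cardinal_pair κ : is_uncountable_cardinal κ -> has_pair κ.
Proof.
move=> [[[tk ok] _] ck]; apply: contrapT => nk; apply: ck.
(* otherwise every member of [κ] would be the empty set or its singleton *)
have sub1 x y z : x ∈ κ -> y ∈ x -> z ∈ x -> y = z.
  move=> xk yx zx; apply: contrapT => yz; apply: nk; exists x; split=> //.
  by exists (mem_of yx), (mem_of zx) => -[].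
suff : elts κ `<=` [set zempty Z; upair (zempty Z) (zempty Z)].
  by move=> /sub_finite_set h; apply: finite_set_countable; apply: h; exact: finite_set2.
move=> x xk; have [[y yx]|x0] := pselect (elts x !=set0); last first.
  by left; apply: zfc_extensionality; rewrite zemptyE; apply: contrapT => /eqP/set0P.
have y0 : y = zempty Z.
  apply: zfc_extensionality; rewrite zemptyE; apply/seteqP; split => // z zy.
  by case: (@mem_irr _ z); rewrite {1}(sub1 _ _ _ xk (ok _ xk _ yx _ zy) yx).
right; apply: zfc_extensionality; rewrite upairE setUid -y0.
by apply/seteqP; split => [z zx|_ ->//]; exact: (sub1 _ _ _ xk zx yx).
Qed.

Section Theory.
Variables (κ : Z) (T : Type) (U : set_system T).
Hypotheses (k2 : has_pair κ) (uU : ultra_complete κ U).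

Lemma ultra_complete_sub X Y : X `<=` Y -> U X -> U Y.
Proof.
move=> XY UX; have [ξ [xk [e0 _]]] := k2.
by apply: (uU.2 ξ (fun=> X)) => // t /(_ e0); exact: XY.
Qed.

Lemma ultra_completeI X Y : U X -> U Y -> U (X `&` Y).
Proof.
move=> UX UY; have [ξ [xk [e0 [e1 e01]]]] := k2.
apply: (uU.2 ξ (fun e => if pselect (e = e0) then X else Y)) => //.
  by move=> e; case: pselect.
move=> t h; split.
  by have := h e0; case: pselect.
by have := h e1; case: pselect => // e; case: e01.
Qed.

Lemma ultra_completeT : U setT.
Proof.
have [UT|/uU.1 UT] := pselect (U setT) => //.
by apply: ultra_complete_sub UT.
Qed.

Lemma ultra_complete0 : ~ U set0.
Proof. by apply/uU.1; rewrite setC0; exact: ultra_completeT. Qed.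

Lemma ultra_completeC X : U (~` X) <-> ~ U X. Proof. exact: uU.1. Qed.

Lemma ultra_complete_nonempty X : U X -> X !=set0.
Proof.
by move=> UX; apply/set0P/eqP => X0; apply: ultra_complete0; rewrite -X0.
Qed.

Lemma ultra_complete_filter : ProperFilter U.
Proof.
split; first exact: ultra_complete0.
split; [exact: ultra_completeT|exact: ultra_completeI|exact: ultra_complete_sub].
Qed.

Lemma ultra_complete_bigcap ξ (X : ξ -> set T) : ξ ∈ κ ->
  (forall η, U (X η)) -> U [set t | forall η, X η t].
Proof. by move=> xk UX; apply: (uU.2 ξ X). Qed.

End Theory.

Lemma complete_ultrafilterP κ (U : set_system κ) : is_uncountable_cardinal κ ->
  complete_nonprincipal_ultrafilter U <->
  ultra_complete κ U /\ forall x, ~ U [set x].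
Proof.
move=> uk; have k2 := uncountable_cardinal_pair uk.
have ok : is_ordinal κ := uk.1.1.
split=> [[UU Uc Un]|[uU Un]].
  have PU : ProperFilter U by exact: ultra_proper.
  have n0 := filter_not_empty U.
  split; first split.
  - move=> X; split=> [UC UX|nX].
      by apply: n0; rewrite -(setICr X); exact: filterI.
    by have [//|] := in_ultra_setVsetC X UU.
  - move=> ξ X Y xk UX XY.
    have : U (\bigcap_(A in range X) A).
      apply: Uc; first by move=> _ [η _ <-].
      exact: card_lt_range.
    by apply: filterS => t h; apply: XY => η; apply: h; exists η.
  - move=> x Ux; apply: (Un x); apply/seteqP; split=> A.
      move=> UA; apply/principal_filterP; apply: contrapT => nA; apply: n0.
      apply: filterS (filterI UA Ux) => t [At tx].
      by apply: nA; rewrite -tx.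
    by move=> /principal_filterP Ax; apply: filterS Ux => _ ->.
have FU := ultra_complete_filter k2 uU.
split.
- split=> // G FG UG; apply/seteqP; split=> // X GX.
  apply: contrapT => /uU.1/UG GC; apply: (@filter_not_empty _ G _).
  by rewrite -(setICr X); exact: filterI.
- move=> A AU /card_lt_enum[ξ [X [xk XA]]].
  apply: (uU.2 ξ X) => //; first by move=> η; apply: AU; rewrite -XA; exists η.
  by move=> t h B; rewrite -XA => -[η _ <-].
- by move=> x Ux; apply: (Un x); rewrite Ux; exact/principal_filterP.
Qed.

(** A proper initial segment of [κ] is a union of fewer than [κ] singletons. *)
Lemma ultra_complete_final κ (U : set_system κ) : is_ordinal κ -> has_pair κ ->
  ultra_complete κ U -> (forall x, ~ U [set x]) ->
  forall ξ, ξ ∈ κ -> U [set α : κ | ξ ∈ val α].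
Proof.
move=> ok k2 uU Un ξ xk.
have sub (η : ξ) : val η ∈ κ by exact: ok.1 xk _ (set_valP η).
have UC (x : κ) : U (~` [set x]) by apply/uU.1/Un.
have := ultra_completeI k2 uU (UC (mem_of xk))
  (ultra_complete_bigcap uU xk (fun η => UC (mem_of (sub η)))).
apply: (ultra_complete_sub k2 uU) => α [/= nx nl].
have oa : is_ordinal (val α) by exact: ordinal_mem ok (set_valP α).
have [//|e|ax] := ordinal_trichotomy (ordinal_mem ok xk) oa.
  by case: nx; exact: val_inj.
by case: (nl (mem_of ax)); exact: val_inj.
Qed.

End CompleteUltrafilters.

(** * Small types *)

Section Small.
Variable Z : zfc_universe.

Lemma small_le T (A : set T) (a : Z) : A #<= elts a -> is_small Z A.
Proof.
move=> /card_subP[B BA Ba]; have [b bE] := setlike_sub Ba.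
by exists b; rewrite bE card_eq_sym.
Qed.

Lemma small_image X Y (f : X -> Y) (h : X -> Z) (C : set X) (b : Z) :
  (forall x, C x -> h x ∈ b) ->
  (forall x y, C x -> C y -> h x = h y -> x = y) -> is_small Z (f @` C).
Proof.
move=> hb hi; apply: (@small_le _ _ b).
apply: card_le_trans (card_image_le _ _) _.
have hE : h @` C #= C.
  by apply: inj_card_eq => x y /set_mem Cx /set_mem Cy; exact: hi.
rewrite -(card_le_eql hE); apply: subset_card_le => _ [x Cx <-]; exact: hb.
Qed.

Lemma small_enum T (A : set T) : is_small Z A ->
  exists (a : Z) (f : a -> T), range f = A.
Proof.
move=> [a /card_bijP[f [g fK gK]]]; exists a, (fun u => val (g u)).
apply/seteqP; split => [_ [u _ <-]|x Ax]; first exact: set_valP.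
by exists (f (SigSub (mem_set Ax))) => //; rewrite fK.
Qed.

Lemma choose_in_default T (d d' : T) (P : set T) : P !=set0 -> choose_in d P = choose_in d' P.
Proof. by rewrite /choose_in; case: pselect. Qed.

(** The quotient is carried by the codes of chosen representatives, which depend
    only on the class since they are chosen in it. *)
Lemma small_quotient X (h : X -> Z) (b : Z) (E : X -> X -> Prop) :
  (forall x, h x ∈ b) -> injective h ->
  (forall x, E x x) -> (forall x y, E x y -> E y x) ->
  (forall x y z, E x y -> E y z -> E x z) ->
  exists (C : Z) (q : X -> C),
    (forall c, exists x, q x = c) /\ (forall x y, q x = q y <-> E x y).
Proof.
move=> hb hi Er Es Et; pose r x := choose_in x (E x).
have rE x : E x (r x) by apply: (@choose_inP _ x (E x)); exists x.
have rP x y : E x y -> r x = r y.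
  move=> xy; have EE : E x = E y.
    by apply: funext => z; apply/propext; split=> [/(Et _ _ _ (Es _ _ xy))|/(Et _ _ _ xy)].
  by rewrite /r EE; apply: choose_in_default; exists y.
have [C CE] : setlike (range (h \o r)).
  by apply: (@setlike_sub _ _ b) => _ [x _ <-]; exact: hb.
have memC z : z ∈ C -> exists x, h (r x) = z by rewrite CE => -[x _ <-]; exists x.
have qC x : h (r x) ∈ C by rewrite CE; exists x.
exists C, (fun x => mem_of (qC x)); split=> [c|x y].
  have [x xc] := memC _ (set_valP c).
  by exists x; exact: val_inj.
split=> [[/hi e]|/rP e]; last by apply: val_inj; rewrite /= e.
by apply: Et (rE x) _; apply: Es; rewrite e.
Qed.

Lemma small_pi (T : Z) (D : T -> Z) : exists (b : Z) (h : (forall i, D i) -> Z),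
  (forall p, h p ∈ b) /\ injective h.
Proof.
have [c cE] := setlike_range D; have [K KE] := zfc_union c.
have DK i x : x ∈ D i -> x ∈ K.
  by rewrite KE cE => xD; exists (D i) => //; exists i.
pose h (p : forall i, D i) := fun_graph (fun i => val (p i)).
have hE p : elts (h p) = range (fun i => opair (val i) (val (p i))) by exact: fun_graphE.
exists (zpow (zprod T K)), h; split=> [p|p p' e].
  rewrite zpowE => z; rewrite hE => -[i _ <-]; rewrite zprodE.
  exists (val i), (val (p i)); split=> //; first exact: set_valP.
  by apply: (DK i); exact: set_valP.
apply: functional_extensionality_dep => i.
have : opair (val i) (val (p i)) ∈ h p by rewrite hE; exists i.
rewrite e hE => -[i' _ /opair_inj[/val_inj ii' e']]; subst i'.
exact/esym/val_inj.
Qed.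

End Small.

(** * The extension property of compact cardinals *)

Section Extension.
Variable Z : zfc_universe.

(** Strong compactness without a language. The hypothesis is on the family itself
    rather than on the complete filter that it generates because it then holds for
    every cardinal below [κ] as soon as it does for [κ]. *)
Definition ultrafilter_extension (κ : Z) := forall (T : Z) (F : set_system T),
  (forall G, G `<=` F -> card_lt G κ -> (\bigcap_(X in G) X) !=set0) ->
  exists U, ultra_complete κ U /\ F `<=` U.

Section CompactExtension.
Variables (κ T : Z) (ξ2 : κ) (e0 e1 : val ξ2).
Hypothesis e01 : e0 <> e1.

(** The propositional language with an atom for each subset [Y] of [T], meant to
    say that [Y] is in the ultrafilter. *)
Let S : signature Z := Signature (fun_sym := zempty Z) (fun=> 0)
  (rel_sym := zpow T) (fun=> 0).

Let prop_atom (Y : zpow T) : formula κ S := Rel (S := S) (r := Y) (fun _ => Var S ξ2).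

Let conj2 (φ ψ : formula κ S) : formula κ S :=
  Conj (ξ := ξ2) (fun η => if pselect (η = e0) then φ else ψ).

Let conj2P (D : structure S) (s : κ -> carrier D) φ ψ :
  satisfies s (conj2 φ ψ) <-> satisfies s φ /\ satisfies s ψ.
Proof.
split=> [/= h|[h1 h2] /= η]; last by case: pselect.
split; first by have := h e0; case: pselect.
by have := h e1; case: pselect => // e; case: e01.
Qed.

Let conj2_free φ ψ v : free_in (conj2 φ ψ) v -> free_in φ v \/ free_in ψ v.
Proof. by move=> [η]; case: pselect => [a|a] h; [left|right]. Qed.

Let code (X : set T) : zpow T := mem_of (sub_of_pow X).
Let decode (Y : zpow T) : set T := [set t | val t ∈ val Y].

Let codeK X : decode (code X) = X.
Proof. by apply/seteqP; split=> t; rewrite /decode/= sub_of_val. Qed.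

Let fiber (g : Z) (η : Z) : set T := [set t | opair η (val t) ∈ g].

(** If all the fibers of [g] over [ξ] are in the ultrafilter then so is [Y];
    moreover exactly one of [Y] and its complement is. *)
Let axiom_of (c : κ * Z * zpow T) : formula κ S :=
  let: (ξ, g, Y) := c in
  conj2
    (Neg (conj2 (Conj (ξ := ξ) (fun η => prop_atom (code (fiber g (val η)))))
                (Neg (prop_atom Y))))
    (conj2
      (Neg (conj2 (prop_atom Y) (prop_atom (code (~` decode Y)))))
      (Neg (conj2 (Neg (prop_atom Y)) (Neg (prop_atom (code (~` decode Y))))))).

Let axiom_sentence c : sentence (axiom_of c).
Proof.
case: c => [[ξ g] Y] v.
have atom Y' : ~ free_in (prop_atom Y') v by case=> i _; have := ltn_ord i.
have dis A B : ~ free_in A v -> ~ free_in B v -> ~ free_in (conj2 A B) v.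
  by move=> nA nB /conj2_free[].
have con f : ~ free_in (Conj (ξ := ξ) (fun η => prop_atom (f η))) v.
  by move=> [η] /atom.
apply dis; first by apply dis; [exact: con|exact: atom].
by apply dis; apply dis; exact: atom.
Qed.

(** The implications that hold at every point of [T], and those whose conclusion
    is a member of [F], which stand for the axioms that [F] is included in the
    ultrafilter. *)
Let axiom_ok (F : set_system T) (c : κ * Z * zpow T) :=
  c.1.2 ∈ zpow (zprod κ T) /\
  ((forall t, (forall η : val c.1.1, fiber c.1.2 (val η) t) -> decode c.2 t) \/
   F (decode c.2)).

Let axioms_small F : is_small Z (axiom_of @` axiom_ok F).
Proof.
pose h (c : κ * Z * zpow T) := opair (val c.1.1) (opair c.1.2 (val c.2)).
apply: (@small_image _ _ _ axiom_of h (axiom_ok F)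
  (zprod κ (zprod (zpow (zprod κ T)) (zpow T)))) => [[[ξ g] Y] [/= gp _]|].
  rewrite zprodE; exists (val ξ), (opair g (val Y)); split=> //; first exact: set_valP.
  rewrite zprodE; exists g, (val Y); split=> //; exact: set_valP.
move=> [[ξ g] Y] [[ξ' g'] Y'] _ _ /opair_inj[/= /val_inj -> /opair_inj[-> /val_inj ->]].
by [].
Qed.

(** A point of [T] makes the atom of [Y] true when it belongs to [Y]. *)
Let point_model (t : T) : structure S :=
  @Structure Z S κ (ex_intro _ (val ξ2) (set_valP ξ2)) (fun _ _ => ξ2)
    (fun Y _ => decode Y t).

Let point_modelP (F : set_system T) (c : κ * Z * zpow T) t
    (s : κ -> carrier (point_model t)) :
  axiom_ok F c -> (F (decode c.2) -> decode c.2 t) -> satisfies s (axiom_of c).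
Proof.
case: c => [[ξ g] Y] [/= gp] h Ft; rewrite /axiom_of.
apply/conj2P; split; last first.
  by apply/conj2P; split=> /conj2P[/=]; rewrite codeK.
move=> /conj2P[/= hX]; case: h => [XY|/Ft//]; apply; apply: XY => η.
by have := hX η; rewrite codeK.
Qed.

(** Fewer than [κ] axioms mention fewer than [κ] members of [F], and a common point
    of these members gives a model of the axioms. *)
Lemma compact_extension_aux (F : set_system T) : compact_cardinal κ ->
  (forall G, G `<=` F -> card_lt G κ -> (\bigcap_(X in G) X) !=set0) ->
  exists U, ultra_complete κ U /\ F `<=` U.
Proof.
move=> [[[ok _] _] kc] FG.
have [|||D DS] := kc S (axiom_of @` axiom_ok F).
- exact: axioms_small.
- by move=> _ [c _ <-]; exact: axiom_sentence.
- move=> Σ0 sub lt.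
  have /choice[c cP] φ : exists c, Σ0 φ -> axiom_ok F c /\ axiom_of c = φ.
    have [/sub[c ? ?]|] := pselect (Σ0 φ); first by exists c.
    by move=> ?; exists (ξ2, zempty Z, code set0).
  have [||t tG] := FG ((fun φ => decode (c φ).2) @` Σ0 `&` F).
  + by move=> ? [].
  + apply: card_lt_le lt _ => //.
    apply: card_le_trans (card_image_le (fun φ => decode (c φ).2) _).
    exact: subset_card_le.
  exists (point_model t) => φ Sφ s; have [okc <-] := cP _ Sφ.
  apply: point_modelP; first exact: okc.
  by move=> Fc; apply: (tG (decode (c φ).2)); split=> //; exists φ.
have [x0 x0D] := carrier_nonempty D.
pose s (_ : κ) : carrier D := mem_of x0D.
pose U X := satisfies s (prop_atom (code X)).
have ax (ξ : κ) g Y : axiom_ok F (ξ, g, code Y) ->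
    ((forall η : val ξ, U (fiber g (val η))) -> U Y) /\ (U (~` Y) <-> ~ U Y).
  move=> ok'.
  have /DS/(_ s) : (axiom_of @` axiom_ok F) (axiom_of (ξ, g, code Y)) by exists (ξ, g, code Y).
  move=> /conj2P[h1 /conj2P[h2 h3]]; split.
    by move=> UX; apply: contrapT => nY; apply: h1; apply/conj2P; split.
  rewrite -/(U Y) in h2 h3 *; rewrite !codeK in h2 h3; split.
    by move=> UC UY; apply: h2; apply/conj2P.
  by move=> nU; apply: contrapT => nUC; apply: h3; apply/conj2P.
have g0 : zempty Z ∈ zpow (zprod κ T) by rewrite zpowE /= zemptyE.
have Ucomp (ξ : Z) (X : ξ -> set T) (Y : set T) : ξ ∈ κ ->
    (forall t, (forall η, X η t) -> Y t) \/ F Y -> (forall η, U (X η)) -> U Y.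
  move=> xk XY UX.
  have fibE (η : ξ) : fiber (family_graph X) (val η) = X η.
    by apply/seteqP; split=> t; rewrite /fiber /= mem_family_graph.
  have [|h _] := ax (mem_of xk) (family_graph X) Y.
    split; first by apply: family_graph_pow; exact: ok.1 xk.
    case: XY => XY; [left|by right; rewrite codeK].
    by move=> t h; rewrite codeK; apply: XY => η; rewrite -fibE; exact: h.
  by apply: h => η; rewrite fibE.
have UC X : U (~` X) <-> ~ U X.
  have [|_ //] := ax ξ2 (zempty Z) X; split=> //=; left=> t /(_ e0).
  by rewrite /fiber/= zemptyE.
exists U; split; first split=> //.
  by move=> ξ X Y xk UX XY; apply: Ucomp UX => //; left.
move=> Y FY; apply: contrapT => /UC nY.
(* the axiom with conclusion [Y] applies to any premise in [U], such as [~` Y] *)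
have := (UC Y).1 nY; apply; apply: (Ucomp (val ξ2) (fun _ => ~` Y)) => //.
  exact: set_valP.
by right.
Qed.

End CompactExtension.

Lemma compact_extension κ : compact_cardinal κ -> ultrafilter_extension κ.
Proof.
move=> kc T F FG; have [ξ [xk [e0 [e1 e01]]]] := uncountable_cardinal_pair kc.1.
exact: (@compact_extension_aux κ T (mem_of xk) e0 e1).
Qed.

End Extension.

(** * Ultraproducts and compactness *)

Section Ultraproduct.
Variable Z : zfc_universe.
Variables (κ T : Z) (U : set_system T) (S : signature Z) (D : T -> structure S).
Hypotheses (ok : is_ordinal κ) (k2 : has_pair κ) (uU : ultra_complete κ U).

Let P := forall i, carrier (D i).

Lemma ultra_complete_forall_ord n (X : 'I_n -> set T) :
  (forall k, U (X k)) -> U [set t | forall k, X k t].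
Proof.
move=> UX; have FU := ultra_complete_filter k2 uU.
exact: (@filter_forall _ _ X).
Qed.

Lemma ultraproduct_exists : exists (C : Z) (q : P -> C),
  (forall c, exists p, q p = c) /\
  (forall p p', q p = q p' <-> U [set i | p i = p' i]).
Proof.
have [b [h [hb hi]]] := small_pi (fun i => carrier (D i)).
apply: (small_quotient hb hi) => [p|p p'|p p' p''].
- exact: (ultra_complete_sub k2 uU) (ultra_completeT k2 uU).
- by apply: (ultra_complete_sub k2 uU) => i /= ->.
- move=> h1 h2; apply: (ultra_complete_sub k2 uU) (ultra_completeI k2 uU h1 h2).
  by move=> i [/= -> ->].
Qed.

Variables (C : Z) (q : P -> C).
Hypothesis q_surj : forall c, exists p, q p = c.
Hypothesis q_eq : forall p p', q p = q p' <-> U [set i | p i = p' i].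

Let point : P := fun i => mem_of (projT2 (cid (carrier_nonempty (D i)))).

Let rep (c : C) : P := projT1 (cid (q_surj c)).

Let repK c : q (rep c) = c. Proof. exact: projT2 (cid (q_surj c)). Qed.

Definition ultraproduct : structure S :=
  @Structure Z S C (ex_intro _ (val (q point)) (set_valP (q point)))
    (fun f a => q (fun i => fun_interp (fun k => rep (a k) i)))
    (fun r a => U [set i | rel_interp (fun k => rep (a k) i)]).

Let rep_args n (p : 'I_n -> P) :
  U [set i | (fun k => rep (q (p k)) i) = (fun k => p k i)].
Proof.
apply: (ultra_complete_sub k2 uU) (@ultra_complete_forall_ord n
  (fun k => [set i | rep (q (p k)) i = p k i]) _).
  by move=> i h; apply: functional_extensionality_dep => k; exact: h.
by move=> k; apply/q_eq; rewrite repK.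
Qed.

Lemma eval_ultraproduct (σ : κ -> P) (t : term κ S) :
  eval (D := ultraproduct) (q \o σ) t =
  q (fun i => eval (fun v => σ v i) t).
Proof.
elim: t => [//|f t IH] /=; apply/q_eq.
pose p k : P := fun i => eval (fun v => σ v i) (t k).
apply: (ultra_complete_sub k2 uU) (rep_args p) => i /= e.
rewrite -[in RHS]/(fun k => p k i) -e; congr fun_interp.
by apply: functional_extensionality_dep => k; rewrite IH.
Qed.

(** Łoś's theorem: completeness of the ultrafilter is what lets it go through
    conjunctions of length less than [κ]. *)
Lemma satisfies_ultraproduct (φ : formula κ S) (σ : κ -> P) :
  satisfies (D := ultraproduct) (q \o σ) φ <->
  U [set i | satisfies (fun v => σ v i) φ].
Proof.
elim: φ σ => [t u|r t|φ IH|ξ Φ IH|ξ x φ IH] σ.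
- by rewrite [X in X <-> _]/= !eval_ultraproduct q_eq.
- pose p k : P := fun i => eval (fun v => σ v i) (t k).
  have -> : satisfies (D := ultraproduct) (q \o σ) (Rel t) =
      U [set i | rel_interp (fun k => rep (q (p k)) i)].
    rewrite /=; congr U; apply/funext => i; congr rel_interp.
    by apply: funext => k; rewrite eval_ultraproduct.
  by split=> h; apply: (ultra_complete_sub k2 uU) (ultra_completeI k2 uU h (rep_args p))
    => i [/= + e]; rewrite e.
- by rewrite [X in X <-> _]/= IH -(ultra_completeC uU).
- split=> [h|h η].
    apply: (ultra_complete_bigcap uU (X := fun η => [set i | satisfies (fun v => σ v i) (Φ η)])).
      exact: set_valP.
    by move=> η; apply/IH/h.
  by apply/IH; apply: (ultra_complete_sub k2 uU) h => i; apply.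
- split=> [h|h s' s'E].
    apply: contrapT => /(ultra_completeC uU) nU.
    (* counterexamples chosen in almost every factor make one in the ultraproduct *)
    have sex (i : T) : exists s : κ -> carrier (D i),
        (forall v, (forall η, x η <> v) -> s v = σ v i) /\
        (~ satisfies (fun v => σ v i) (Forall x φ) -> ~ satisfies s φ).
      have [?|/existsNP[s /not_implyP[sE ns]]] :=
          pselect (satisfies (fun v => σ v i) (Forall x φ)).
        by exists (fun v => σ v i).
      by exists s.
    pose s i := projT1 (cid (sex i)); have sP i := projT2 (cid (sex i)).
    rewrite -/(s _) in sP; pose σ' v : P := fun i => s i v.
    have /IH Uφ : satisfies (D := ultraproduct) (q \o σ') φ.
      apply: h => v xv /=; congr q; apply: functional_extensionality_dep => i.
      exact: (sP i).1.
    have := ultra_completeI k2 uU nU Uφ => /(ultra_complete_nonempty k2 uU)[i [/= ni]].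
    exact: (sP i).2 ni.
  pose σ' v := if pselect (exists η, x η = v) then rep (s' v) else σ v.
  have s'σ : s' = q \o σ'.
    apply: funext => v /=; rewrite /σ'; case: pselect => [a|nv]; first by rewrite repK.
    by apply: s'E => η e; apply: nv; exists η.
  rewrite s'σ; apply/IH; apply: (ultra_complete_sub k2 uU) h => i /=; apply => v xv.
  rewrite /σ'; case: (pselect (exists η, x η = v)) => h //.
  by have [η /xv] := h.
Qed.

End Ultraproduct.

Section Compactness.
Variable Z : zfc_universe.
Implicit Types κ : Z.

(** The index set consists of the small parts of the theory. The sets of indices
    containing a given sentence have the small intersection property, so some
    complete ultrafilter contains them, and almost every factor of the
    corresponding ultraproduct satisfies the sentence. *)
Lemma extension_compact κ : is_uncountable_cardinal κ ->
  ultrafilter_extension κ -> compact_cardinal κ.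
Proof.
move=> uk ext; split=> // S Σ Σsmall _ Σmod.
have ok : is_ordinal κ := uk.1.1.
have k2 := uncountable_cardinal_pair uk.
have [a [ph phE]] := small_enum Σsmall.
have [T TE] : setlike [set x : Z | x ∈ zpow a /\ card_lt (elts x) κ].
  by apply: (@setlike_sub _ _ (zpow a)) => x [].
have memT x : x ∈ T <-> x ∈ zpow a /\ card_lt (elts x) κ by rewrite TE.
pose hat (u : a) : set T := [set i : T | val u ∈ val i].
have single (u : a) : upair (val u) (val u) ∈ T.
  apply/memT; rewrite zpowE /= upairE setUid; split.
    by move=> _ ->; exact: set_valP.
  have [ξ [xk [e0 _]]] := k2.
  rewrite (_ : [set val u] = range (fun _ : ξ => val u)); first exact: card_lt_range.
  by apply/seteqP; split=> [_ ->|_ [_ _ <-]//]; exists e0.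
have hatI : injective hat.
  move=> u v e; have : hat v (mem_of (single v)) by rewrite /hat /= upairE; left.
  by rewrite -e /hat /= upairE => -[] /val_inj.
have [G GF Glt|U [uU FU]] := ext T (range hat).
  pose x := sub_of [set u : a | G (hat u)].
  have xT : x ∈ T.
    apply/memT; split; first exact: sub_of_pow.
    rewrite sub_ofE; apply: card_lt_le ok Glt _.
    apply: card_le_trans (card_image_le _ _) _.
    have hE : hat @` [set u : a | G (hat u)] #= [set u : a | G (hat u)].
      by apply: inj_card_eq => u v _ _; exact: hatI.
    by rewrite -(card_le_eql hE); apply: subset_card_le => _ [u Gu <-].
  exists (mem_of xT) => X GX; have [u _ uX] := GF _ GX.
  by rewrite -uX; apply/sub_of_val; rewrite /= uX.
have modT (i : T) : has_model (ph @` [set u | val u ∈ val i]).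
  apply: Σmod; first by move=> _ [u _ <-]; rewrite -phE; exists u.
  have [_ ilt] := (memT _).1 (set_valP i).
  apply: card_lt_le ok ilt _; apply: card_le_trans (card_image_le _ _) _.
  have vE : val @` [set u : a | val u ∈ val i] #= [set u : a | val u ∈ val i].
    by apply: inj_card_eq => u v _ _; exact: val_inj.
  by rewrite -(card_le_eql vE); apply: subset_card_le => _ [u ui <-].
pose D i := projT1 (cid (modT i)); have DP i := projT2 (cid (modT i)).
rewrite -/(D _) in DP.
have [C [q [qs qe]]] := ultraproduct_exists D k2 uU.
exists (ultraproduct U qs) => φ; rewrite -phE => -[u _ <-] s.
have /choice[σ σE] v : exists p, q p = s v by exact: qs.
have <- : q \o σ = s by apply: funext => v /=.
apply/(satisfies_ultraproduct k2 uU qs qe).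
apply: (ultra_complete_sub k2 uU) (FU (hat u) _); last by exists u.
by move=> i ui; apply: (DP i); exists u.
Qed.

(** For a sequence of [ξ] members of the average, completeness of [W] puts them all
    in [U i] for almost every [i], and [U i] is complete enough for almost every
    [i]. *)
Lemma ultra_complete_average κ I T (W : set_system I) (U : I -> set_system T)
    (c : I -> Z) : has_pair κ -> ultra_complete κ W ->
  W [set i | ultra_complete (c i) (U i)] ->
  (forall ξ, ξ ∈ κ -> W [set i | ξ ∈ c i]) ->
  ultra_complete κ [set X | W [set i | U i X]].
Proof.
move=> k2 uW WU Wc; split=> [X|ξ X Y xk UX XY] /=.
  rewrite -(ultra_completeC uW); split=> h;
    by apply: (ultra_complete_sub k2 uW) (ultra_completeI k2 uW WU h) => i [/= [+ _] +];
    move=> ->.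
have := ultra_completeI k2 uW WU
  (ultra_completeI k2 uW (Wc _ xk) (ultra_complete_bigcap uW xk UX)).
apply: (ultra_complete_sub k2 uW) => i [/= uUi [xc UiX]].
exact: (uUi.2 ξ X).
Qed.

(** A theorem of Menas. For each [α] below [κ], the family extends to an
    ultrafilter that is complete for some compact cardinal above [α]; the average of
    these along a nonprincipal ultrafilter on [κ] is [κ]-complete. *)
Lemma measurable_limit_compact κ (W : set_system κ) : is_uncountable_cardinal κ ->
  ultra_complete κ W -> (forall x, ~ W [set x]) ->
  (forall ξ, ξ ∈ κ -> exists2 μ, ξ ∈ μ & μ ∈ κ /\ compact_cardinal μ) ->
  compact_cardinal κ.
Proof.
move=> uk uW Wn lim; apply: extension_compact => // T F FG.
have ok : is_ordinal κ := uk.1.1; have k2 := uncountable_cardinal_pair uk.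
have /choice[cU cUP] (α : κ) : exists cU : Z * set_system T,
    val α ∈ cU.1 /\ cU.1 ∈ κ /\ ultra_complete cU.1 cU.2 /\ F `<=` cU.2.
  have [μ am [mk mc]] := lim _ (set_valP α).
  have [G GF [ξ xm Gx]|U [uU FU]] := compact_extension mc (F := F); last by exists (μ, U).
  by apply: FG => //; exists ξ => //; exact: ordinal_trans ok xm mk.
exists [set X | W [set α | (cU α).2 X]]; split.
  apply: (ultra_complete_average (c := fun α => (cU α).1)) => //.
    apply: (ultra_complete_sub k2 uW) (ultra_completeT k2 uW) => α _.
    exact: (cUP α).2.2.1.
  move=> ξ xk; apply: (ultra_complete_sub k2 uW) (ultra_complete_final ok k2 uW Wn xk).
  move=> α xa /=; have [ac [ck _]] := cUP α.
  exact: ordinal_trans (ordinal_mem ok ck) xa ac.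
move=> X FX; apply: (ultra_complete_sub k2 uW) (ultra_completeT k2 uW) => α _.
exact: (cUP α).2.2.2.
Qed.

End Compactness.

(** * Truth in a transitive class *)

Definition StImp φ ψ := StNeg (StAnd φ (StNeg ψ)).
Definition StOr φ ψ := StImp (StNeg φ) ψ.
Definition StIff φ ψ := StAnd (StImp φ ψ) (StImp ψ φ).
Definition StEx φ := StNeg (StAll (StNeg φ)).
Definition StAllIn i φ := StAll (StImp (StMem 0 i.+1) φ).
Definition StExIn i φ := StEx (StAnd (StMem 0 i.+1) φ).
Definition StUpair p x y :=
  StAll (StIff (StMem 0 p.+1) (StOr (StEq 0 x.+1) (StEq 0 y.+1))).
Definition StPair p x y :=
  StEx (StEx (StAnd (StUpair 1 x.+2 x.+2)
    (StAnd (StUpair 0 x.+2 y.+2) (StUpair p.+2 1 0)))).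

Section Reflection.
Variables (Z : zfc_universe) (M : set Z).
Hypothesis tM : transitive_class M.
Implicit Types (e : nat -> Z) (P Q : Prop).

Definition env_in e := forall n, M (e n).

Lemma env_in_cons x e : M x -> env_in e -> env_in (env_cons x e).
Proof. by move=> Mx Me [|n] /=. Qed.

Lemma sat_neg e φ P : (st_satisfies M e φ <-> P) -> (st_satisfies M e (StNeg φ) <-> ~ P).
Proof. by move=> /= ->. Qed.

Lemma sat_and e φ ψ P Q : (st_satisfies M e φ <-> P) -> (st_satisfies M e ψ <-> Q) ->
  (st_satisfies M e (StAnd φ ψ) <-> P /\ Q).
Proof. by move=> /= -> ->. Qed.

Lemma sat_imp e φ ψ P Q : (st_satisfies M e φ <-> P) -> (st_satisfies M e ψ <-> Q) ->
  (st_satisfies M e (StImp φ ψ) <-> (P -> Q)).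
Proof.
by move=> /= -> ->; split=> [h p|h [p]]; [apply: contrapT => q; exact: h|apply; exact: h].
Qed.

Lemma sat_or e φ ψ P Q : (st_satisfies M e φ <-> P) -> (st_satisfies M e ψ <-> Q) ->
  (st_satisfies M e (StOr φ ψ) <-> P \/ Q).
Proof.
move=> hP hQ; rewrite (sat_imp (sat_neg hP) hQ); split=> [h|[//|//]].
by have [|/h] := pselect P; [left|right].
Qed.

Lemma sat_iff e φ ψ P Q : (st_satisfies M e φ <-> P) -> (st_satisfies M e ψ <-> Q) ->
  (st_satisfies M e (StIff φ ψ) <-> (P <-> Q)).
Proof.
by move=> hP hQ; rewrite (sat_and (sat_imp hP hQ) (sat_imp hQ hP)).
Qed.

Lemma sat_all e φ (P : Z -> Prop) : env_in e ->
  (forall x, M x -> env_in (env_cons x e) -> (st_satisfies M (env_cons x e) φ <-> P x)) ->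
  (st_satisfies M e (StAll φ) <-> forall x, M x -> P x).
Proof.
by move=> Me hP; split=> /= h x Mx; apply/hP => //; [exact: env_in_cons|exact: h|
  exact: env_in_cons|exact: h].
Qed.

Lemma sat_ex e φ (P : Z -> Prop) : env_in e ->
  (forall x, M x -> env_in (env_cons x e) -> (st_satisfies M (env_cons x e) φ <-> P x)) ->
  (st_satisfies M e (StEx φ) <-> exists2 x, M x & P x).
Proof.
move=> Me hP; rewrite (sat_neg (sat_all Me (fun x Mx Mxe => sat_neg (hP x Mx Mxe)))).
split=> [/existsNP[x /not_implyP[Mx /contrapT Px]]|[x Mx Px] h]; first by exists x.
exact: h Mx Px.
Qed.

Lemma sat_allin e i φ (P : Z -> Prop) : env_in e ->
  (forall x, M x -> env_in (env_cons x e) -> (st_satisfies M (env_cons x e) φ <-> P x)) ->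
  (st_satisfies M e (StAllIn i φ) <-> forall x, x ∈ e i -> P x).
Proof.
move=> Me hP; rewrite (sat_all Me (fun x Mx Mxe => sat_imp (iff_refl _) (hP x Mx Mxe))) /=.
split=> h x; last by move=> _; exact: h.
by move=> xe; apply: h => //; exact: tM xe.
Qed.

Lemma sat_exin e i φ (P : Z -> Prop) : env_in e ->
  (forall x, M x -> env_in (env_cons x e) -> (st_satisfies M (env_cons x e) φ <-> P x)) ->
  (st_satisfies M e (StExIn i φ) <-> exists2 x, x ∈ e i & P x).
Proof.
move=> Me hP; rewrite (sat_ex Me (fun x Mx Mxe => sat_and (iff_refl _) (hP x Mx Mxe))) /=.
split=> [[x _ [xe Px]]|[x xe Px]]; exists x => //; exact: tM xe.
Qed.

(** Pairs are absolute: their components belong to the transitive class. *)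
Lemma sat_upair e p x y : env_in e ->
  (st_satisfies M e (StUpair p x y) <-> e p = upair (e x) (e y)).
Proof.
move=> Me; rewrite (sat_all Me (fun x Mx Mxe => sat_iff (iff_refl _)
  (sat_or (iff_refl _) (iff_refl _)))) /=.
split=> [h|-> z _]; last by rewrite upairE.
apply: zfc_extensionality; rewrite upairE; apply/seteqP; split=> z.
  by move=> zp; apply/h => //; exact: tM zp.
by move=> zxy; apply/h => //; case: zxy => ->.
Qed.

Lemma sat_pair e p x y : env_in e ->
  (st_satisfies M e (StPair p x y) <-> e p = opair (e x) (e y)).
Proof.
move=> Me.
rewrite (sat_ex Me (fun a Ma Mae => sat_ex Mae (fun b Mb Mbe =>
  sat_and (sat_upair _ _ _ Mbe) (sat_and (sat_upair _ _ _ Mbe) (sat_upair _ _ _ Mbe))))) /=.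
split=> [[a _ [b _ [-> [-> //]]]]|pE].
have Mp u : u ∈ e p -> M u by exact: tM.
exists (upair (e x) (e x)); first by apply: Mp; rewrite pE upairE; left.
by exists (upair (e x) (e y)) => //; apply: Mp; rewrite pE upairE; right.
Qed.

End Reflection.

(** Follows the formula to show that its truth in a transitive class is the
    proposition on the right of the equivalence; the sat lemmas read bounded
    quantifiers as ranging over all the members of their bound, as transitivity
    allows. *)
Ltac sat :=
  lazymatch goal with
  | |- env_in _ (env_cons _ _) => assumption
  | |- env_in _ _ => first [assumption | by [] ]
  | |- st_satisfies _ _ (StImp _ _) <-> _ => refine (sat_imp _ _); sat
  | |- st_satisfies _ _ (StOr _ _) <-> _ => refine (sat_or _ _); sat
  | |- st_satisfies _ _ (StIff _ _) <-> _ => refine (sat_iff _ _); sat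
  | |- st_satisfies _ _ (StAnd _ _) <-> _ => refine (sat_and _ _); sat
  | |- st_satisfies _ _ (StNeg _) <-> _ => refine (sat_neg _); sat
  | |- st_satisfies _ _ (StEx _) <-> _ => refine (sat_ex _ _); [sat|intros ? ? ?; sat]
  | |- st_satisfies _ _ (StAll _) <-> _ => refine (sat_all _ _); [sat|intros ? ? ?; sat]
  | |- st_satisfies _ _ (StAllIn _ _) <-> _ =>
      refine (sat_allin _ _ _ _); [eassumption|sat|intros ? ? ?; sat]
  | |- st_satisfies _ _ (StExIn _ _) <-> _ =>
      refine (sat_exin _ _ _ _); [eassumption|sat|intros ? ? ?; sat]
  | |- st_satisfies _ _ (StPair _ _ _) <-> _ => refine (sat_pair _ _ _ _ _); [eassumption|sat]
  | |- _ => exact (iff_refl _)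
  end.

(** * Elementary embeddings *)

Section Embedding.
Variables (Z : zfc_universe) (M : set Z) (j : Z -> Z).
Hypotheses (tM : transitive_class M) (jM : elementary_embedding M j).
Implicit Types (x y z : Z).

(** Elementarity for [P] and [Q], the readings of one formula in the universe and
    in [M]. *)
Lemma transfer φ e P Q :
  (transitive_class [set: Z] -> env_in setT e -> (st_satisfies setT e φ <-> P)) ->
  (env_in M (j \o e) -> (st_satisfies M (j \o e) φ <-> Q)) -> (P <-> Q).
Proof.
move=> hP hQ; rewrite -hP// -hQ; first exact: jM.2.
by move=> n; exact: jM.1.
Qed.

Notation "⟨ a , .. , b | c ⟩" := (env_cons a .. (env_cons b (fun _ => c)) ..).

Lemma embed_mem x y : x ∈ y <-> j x ∈ j y.
Proof. by apply: (transfer (φ := StMem 0 1) (e := ⟨ x | y ⟩)) => *; sat. Qed.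

Lemma embed_compl a x y : (forall z, z ∈ a -> (z ∈ x <-> ~ z ∈ y)) <->
  (forall z, z ∈ j a -> (z ∈ j x <-> ~ z ∈ j y)).
Proof.
by apply: (transfer (φ := StAllIn 0 (StIff (StMem 0 2) (StNeg (StMem 0 3))))
  (e := ⟨ a, x | y ⟩)) => *; sat.
Qed.

Lemma embed_family a x g w :
  (forall z, z ∈ a -> (forall η, η ∈ x -> exists2 p, p ∈ g & p = opair η z) -> z ∈ w) <->
  (forall z, z ∈ j a ->
    (forall η, η ∈ j x -> exists2 p, p ∈ j g & p = opair η z) -> z ∈ j w).
Proof.
by apply: (transfer (φ := StAllIn 0 (StImp
    (StAllIn 2 (StExIn 4 (StPair 0 1 2))) (StMem 0 4)))
  (e := ⟨ a, x, g | w ⟩)) => *; sat.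
Qed.

Lemma embed_fiber x η g : (forall z, z ∈ x -> exists2 p, p ∈ g & p = opair η z) <->
  (forall z, z ∈ j x -> exists2 p, p ∈ j g & p = opair (j η) z).
Proof.
by apply: (transfer (φ := StAllIn 0 (StExIn 3 (StPair 0 3 1)))
  (e := ⟨ x, η | g ⟩)) => *; sat.
Qed.

Lemma embed_trans x : (forall y, y ∈ x -> forall z, z ∈ y -> z ∈ x) <->
  (forall y, y ∈ j x -> forall z, z ∈ y -> z ∈ j x).
Proof.
by apply: (transfer (φ := StAllIn 0 (StAllIn 0 (StMem 0 2)))
  (e := fun=> x)) => *; sat.
Qed.

(** The class [M] satisfies the axiom that the range of a relation is a set. *)
Lemma range_in_target g : M g ->
  exists2 r, M r & forall y, y ∈ r <-> exists2 p, p ∈ g & exists2 x, M x & p = opair x y.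
Proof.
pose ranges (N : set Z) := forall g, N g -> exists2 r, N r & forall y, N y ->
  (y ∈ r <-> exists2 p, p ∈ g & exists2 x, N x & p = opair x y).
have elem : ranges setT <-> ranges M.
  rewrite /ranges; apply: (transfer (φ := StAll (StEx (StAll (StIff (StMem 0 1)
    (StExIn 2 (StEx (StPair 1 0 2))))))) (e := fun=> zempty Z)) => *; sat.
have : ranges setT.
  move=> {}g _.
  have [|r rE] := @setlike_replace Z (fun p y => exists x, p = opair x y) g.
    by move=> p y y' _ [x ->] [x' /opair_inj[]].
  exists r => // y _; rewrite rE; split=> [[p pg [x px]]|[p pg [x _ px]]].
    by exists p => //; exists x.
  by exists p => //; exists x.
move=> /elem h Mg; have [r Mr rP] := h g Mg; exists r => // y; split.
  by move=> yr; apply/rP => //; exact: tM yr.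
move=> [p pg [x Mx pE]]; apply/rP; last by exists p => //; exists x.
have Mp : M p by exact: tM pg.
have Mu : M (upair x y) by apply: (tM Mp); rewrite pE upairE; right.
by apply: (tM Mu); rewrite upairE; right.
Qed.

(** Transfers the small intersection property of a family [b] of subsets of [a]. *)
Lemma embed_meet k b a :
  (forall g, setT g -> forall ξ, ξ ∈ k ->
    (forall η, η ∈ ξ -> exists2 x, x ∈ b & exists2 p, p ∈ g & p = opair η x) ->
    exists2 t, t ∈ a & forall η, η ∈ ξ ->
      exists2 x, x ∈ b & exists2 p, p ∈ g & p = opair η x /\ t ∈ x) <->
  (forall g, M g -> forall ξ, ξ ∈ j k ->
    (forall η, η ∈ ξ -> exists2 x, x ∈ j b & exists2 p, p ∈ g & p = opair η x) ->
    exists2 t, t ∈ j a & forall η, η ∈ ξ ->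
      exists2 x, x ∈ j b & exists2 p, p ∈ g & p = opair η x /\ t ∈ x).
Proof.
by apply: (transfer (φ := StAll (StAllIn 1 (StImp
    (StAllIn 0 (StExIn 4 (StExIn 3 (StPair 0 2 1))))
    (StExIn 4 (StAllIn 1 (StExIn 5 (StExIn 4 (StAnd (StPair 0 2 1) (StMem 3 1)))))))))
  (e := ⟨ k, b | a ⟩)) => *; sat.
Qed.

Lemma embed_bounded ν x : (forall y, y ∈ x -> y ∈ ν \/ y = ν) <->
  (forall y, y ∈ j x -> y ∈ j ν \/ y = j ν).
Proof.
by apply: (transfer (φ := StAllIn 1 (StOr (StMem 0 1) (StEq 0 1)))
  (e := ⟨ ν | x ⟩)) => *; sat.
Qed.

Lemma embed_has_limit x :
  (exists2 ν, ν ∈ x & (exists2 y, y ∈ ν & y = y) /\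
    forall y, y ∈ ν -> exists2 z, z ∈ ν & y ∈ z) <->
  (exists2 ν, ν ∈ j x & (exists2 y, y ∈ ν & y = y) /\
    forall y, y ∈ ν -> exists2 z, z ∈ ν & y ∈ z).
Proof.
by apply: (transfer (φ := StExIn 0 (StAnd (StExIn 0 (StEq 0 0))
  (StAllIn 0 (StExIn 1 (StMem 1 0))))) (e := fun=> x)) => *; sat.
Qed.

Lemma embed_nonempty x : (exists2 y, y ∈ x & y = y) <-> (exists2 y, y ∈ j x & y = y).
Proof.
by apply: (transfer (φ := StExIn 0 (StEq 0 0)) (e := fun=> x)) => *; sat.
Qed.

Lemma embed_singleton ν x : (forall z, z ∈ x -> z = ν) <-> (forall z, z ∈ j x -> z = j ν).
Proof.
by apply: (transfer (φ := StAllIn 1 (StEq 0 1)) (e := ⟨ ν | x ⟩)) => *; sat.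
Qed.

Lemma embed_regressive x f :
  (forall α, α ∈ x -> exists2 β, β ∈ α & exists2 p, p ∈ f & p = opair α β) <->
  (forall α, α ∈ j x -> exists2 β, β ∈ α & exists2 p, p ∈ j f & p = opair α β).
Proof.
by apply: (transfer (φ := StAllIn 0 (StExIn 0 (StExIn 3 (StPair 0 2 1))))
  (e := ⟨ x | f ⟩)) => *; sat.
Qed.

Lemma embed_level x f β y :
  (forall α, α ∈ x -> forall p, p ∈ f -> p = opair α β -> α ∈ y) <->
  (forall α, α ∈ j x -> forall p, p ∈ j f -> p = opair α (j β) -> α ∈ j y).
Proof.
by apply: (transfer (φ := StAllIn 0 (StAllIn 2 (StImp (StPair 0 1 4) (StMem 1 5))))
  (e := ⟨ x, f, β | y ⟩)) => *; sat.
Qed.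

(** In the class [N], [u] is a nonprincipal [β]-complete ultrafilter on [β], and
    [a] is cofinal in [β]. *)
Definition measures (N : set Z) β u a :=
  (forall x, N x -> forall y, N y ->
    (forall z, z ∈ x -> z ∈ β) -> (forall z, z ∈ y -> z ∈ β) ->
    (forall z, z ∈ β -> (z ∈ x <-> ~ z ∈ y)) -> (x ∈ u <-> ~ y ∈ u)) /\
  (forall g, N g -> forall w, N w -> (forall z, z ∈ w -> z ∈ β) ->
    forall ξ, ξ ∈ β ->
    (forall η, η ∈ ξ -> exists2 x, x ∈ u &
      forall z, z ∈ x -> exists2 p, p ∈ g & p = opair η z) ->
    (forall z, z ∈ β -> (forall η, η ∈ ξ -> exists2 p, p ∈ g & p = opair η z) ->
      z ∈ w) -> w ∈ u) /\
  (forall ν, ν ∈ β -> forall x, x ∈ u -> ~ (forall z, z ∈ x -> z = ν)) /\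
  (forall ν, ν ∈ β -> exists2 μ, μ ∈ a & μ ∈ β /\ ν ∈ μ).

Lemma embed_measures k a s :
  (forall β, β ∈ k -> (exists2 u, setT u & measures setT β u a) -> β ∈ s) <->
  (forall β, β ∈ j k -> (exists2 u, M u & measures M β u (j a)) -> β ∈ j s).
Proof.
rewrite /measures.
(* below the quantifier on [u], the indices 0 to 4 stand for [u, β, k, a, s] *)
by apply: (transfer (φ := StAllIn 0 (StImp (StEx (StAnd
    (StAll (StAll (StImp (StAllIn 1 (StMem 0 4)) (StImp (StAllIn 0 (StMem 0 4))
      (StImp (StAllIn 3 (StIff (StMem 0 2) (StNeg (StMem 0 1))))
        (StIff (StMem 1 2) (StNeg (StMem 0 2))))))))
    (StAnd
    (StAll (StAll (StImp (StAllIn 0 (StMem 0 4)) (StAllIn 3 (StImp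
      (StAllIn 0 (StExIn 4 (StAllIn 0 (StExIn 5 (StPair 0 3 1)))))
      (StImp (StAllIn 4 (StImp (StAllIn 1 (StExIn 4 (StPair 0 1 2))) (StMem 0 2)))
        (StMem 1 3)))))))
    (StAnd
      (StAllIn 1 (StAllIn 1 (StNeg (StAllIn 0 (StEq 0 2)))))
      (StAllIn 1 (StExIn 4 (StAnd (StMem 0 3) (StMem 1 0))))))))
    (StMem 0 3)))
  (e := ⟨ k, a | s ⟩)) => *; sat.
Qed.

End Embedding.

(** * Supercompact cardinals *)

Section Derived.
Variables (Z : zfc_universe) (M : set Z) (j : Z -> Z).
Hypotheses (tM : transitive_class M) (jM : elementary_embedding M j).
Implicit Types (x y z : Z).

Definition derived_ultrafilter (T t : Z) : set_system T :=
  [set X | t ∈ j (sub_of X)].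

(** Sequences shorter than [κ] are not lengthened by [j], so their intersection is
    mapped to the intersection of the images of their terms. *)
Lemma derived_ultra_complete (κ T t : Z) : is_ordinal κ ->
  (forall ξ, ξ ∈ κ -> j ξ = ξ) -> t ∈ j T -> ultra_complete κ (derived_ultrafilter (T := T) t).
Proof.
move=> ok jfix tT; split=> [X|ξ X Y xk UX XY]; rewrite /derived_ultrafilter /=.
  have /(embed_compl tM jM) : forall z, z ∈ T -> (z ∈ sub_of (~` X) <-> ~ z ∈ sub_of X).
    by move=> _ /mem_elim[z <-]; rewrite !sub_of_val.
  exact.
have /(embed_family tM jM) : forall z, z ∈ T ->
    (forall η, η ∈ ξ -> exists2 p, p ∈ family_graph X & p = opair η z) -> z ∈ sub_of Y.
  by move=> _ /mem_elim[z <-] /family_graph_meet Xz; exact/sub_of_val/XY.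
apply=> // η; rewrite jfix// => ηx.
have [p pg pE] := (embed_fiber tM jM _ _ _).1 (@family_graph_fiber _ _ _ X (mem_of ηx)) t (UX _).
exists p => //; rewrite {1}pE /= jfix//.
exact: (ok.1 _ xk _ (ηx)).
Qed.

(** If [f] is regressive on a set in the ultrafilter then its image under [j] maps
    [κ] to some [β] in [κ], and [f] is constant of value [β] on a set in the
    ultrafilter because [j] fixes [β]. *)
Lemma derived_normal (κ : Z) : is_uncountable_cardinal κ ->
  (forall ξ, ξ ∈ κ -> j ξ = ξ) -> κ ∈ j κ ->
  normal_ultrafilter (derived_ultrafilter (T := κ) κ).
Proof.
move=> uk jfix kjk; have ok : is_ordinal κ := uk.1.1.
have uU := derived_ultra_complete ok jfix kjk.
split.
  apply/(complete_ultrafilterP _ uk); split=> // ν; rewrite /derived_ultrafilter /= => Uν.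
  have /(embed_singleton tM jM)/(_ _ Uν) : forall z, z ∈ sub_of [set ν] -> z = val ν.
    by move=> z; rewrite sub_ofE => -[_ -> <-].
  rewrite jfix => [kν|]; last exact: set_valP.
  by apply: (@mem_irr _ κ); rewrite {2}kν; exact: set_valP.
move=> X f UX freg.
pose g := fun_graph (fun α => val (f α)).
have gE : elts g = range (fun α => opair (val α) (val (f α))) by exact: fun_graphE.
have /(embed_regressive tM jM)/(_ _ UX)[β βk [p pg pE]] : forall α, α ∈ sub_of X ->
    exists2 β, β ∈ α & exists2 p, p ∈ g & p = opair α β.
  move=> _ /[dup] /sub_of_sub /mem_elim[α <-] /sub_of_val Xα.
  exists (val (f α)); first exact: freg.
  by exists (opair (val α) (val (f α))) => //; rewrite gE; exists α.
pose Y := [set α | X α /\ val (f α) = β].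
exists Y; last first.
  split; first by move=> α [].
  by exists (mem_of βk) => α [_ e]; exact: val_inj.
have /(embed_level tM jM)/(_ _ UX p pg) : forall α, α ∈ sub_of X ->
    forall p, p ∈ g -> p = opair α β -> α ∈ sub_of Y.
  move=> _ /[dup] /sub_of_sub /mem_elim[α <-] /sub_of_val Xα q.
  by rewrite gE => -[α' _ <-] /opair_inj[/val_inj e1 e2]; apply/sub_of_val; rewrite -e1 in Xα *.
by apply; rewrite jfix.
Qed.

Lemma closed_graph (γ : Z) (f : γ -> Z) : closed_under_sequences M γ ->
  (forall ξ, M (f ξ)) -> M (fun_graph f).
Proof.
move=> cM Mf; apply: (cM f Mf); rewrite fun_graphE.
by apply/seteqP; split=> [_ [ξ _ <-]|p [ξ /kpairP->]]; exists ξ => //; exact/kpairP.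
Qed.

Lemma closed_range (γ : Z) (f : γ -> Z) r : closed_under_sequences M γ ->
  (forall ξ, M (f ξ)) -> elts r = range f -> M r.
Proof.
move=> cM Mf rE; pose g := fun_graph f.
have gE : elts g = range (fun ξ => opair (val ξ) (f ξ)) by exact: fun_graphE.
have Mg : M g by exact: closed_graph.
have [r' Mr' r'E] := range_in_target tM jM Mg.
suff -> : r = r' by [].
apply: zfc_extensionality; rewrite rE; apply/seteqP; split=> [_ [ξ _ <-]|y /r'E[p]].
  have pg : opair (val ξ) (f ξ) ∈ g by rewrite gE; exists ξ.
  apply/r'E; exists (opair (val ξ) (f ξ)) => //; exists (val ξ) => //.
  have Mu : M (upair (val ξ) (val ξ)).
    by apply: (tM (tM Mg pg)); rewrite upairE; left.
  by apply: (tM Mu); rewrite upairE; left.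
by rewrite gE => -[ξ _ <-] [x _ /opair_inj[_ <-]]; exists ξ.
Qed.

End Derived.

Section SupercompactCompact.
Variable Z : zfc_universe.
Implicit Types (κ : Z).

Lemma limit_infinite (ν : Z) : is_ordinal ν -> (exists y, y ∈ ν) ->
  (forall y, y ∈ ν -> exists2 z, z ∈ ν & y ∈ z) -> [set: nat] #<= elts ν.
Proof.
move=> on [y0 y0n] lim.
have /choice[s sP] y : exists z, y ∈ ν -> z ∈ ν /\ y ∈ z.
  by have [/lim[z]|] := pselect (y ∈ ν); [exists z|exists y].
pose c n := iter n s y0.
have cn n : c n ∈ ν by elim: n => //= n /sP[].
have clt n k : c n ∈ c (k + n.+1)%N.
  elim: k => [|k IH]; first exact: (sP _ (cn n)).2.
  rewrite addSn; apply: (ordinal_trans _ IH); first exact: ordinal_mem on (cn _).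
  exact: (sP _ (cn _)).2.
have cI : injective c.
  move=> n m cnm; case: (ltngtP n m) => // h.
    have := clt n (m - n.+1)%N; rewrite subnK// -cnm => /mem_irr[].
  by have := clt m (n - m.+1)%N; rewrite subnK// cnm => /mem_irr[].
have cE : c @` setT #= [set: nat] by apply: inj_card_eq => n m _ _; exact: cI.
by rewrite -(card_le_eql cE); apply: subset_card_le => _ [n _ <-].
Qed.

Lemma supercompact_ordinal κ : supercompact_cardinal κ -> is_ordinal κ.
Proof.
move=> sk; have o0 : is_ordinal (zempty Z) by split=> x; rewrite zemptyE.
exact: (sk _ o0).1.1.
Qed.

(** The set [b] is enumerated along some [γ] so that [M] contains the image under
    [j] of each enumeration of a part of [b]. *)
Lemma supercompact_embedding κ (b : Z) : supercompact_cardinal κ -> elts b !=set0 ->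
  exists (γ : Z) (f : γ -> Z) (M : set Z) (j : Z -> Z),
    [/\ elts κ `<=` elts γ, range f = elts b, transitive_class M &
      elementary_embedding M j] /\
    [/\ forall ξ, ξ ∈ κ -> j ξ = ξ, closed_under_sequences M γ, γ ∈ j κ & κ ∈ j κ].
Proof.
move=> sk b0; have ok := supercompact_ordinal sk.
have [γ [og kg [f fb]]] := ordinal_surjection b0 ok.
have [_ [M [j [tM jM [_ _ jfix] cM /(_ kg) gj]]]] := sk γ og.
exists γ, f, M, j; split; split=> //.
have [e|kg'] := ordinal_sub ok og kg; first by rewrite {2}e.
by apply: (embed_trans tM jM κ).1 gj _ kg'; exact: ok.1.
Qed.

(** The critical point [κ] is a limit ordinal, and it belongs to [j κ]; by
    reflection there is a limit ordinal below it, which is infinite and so has the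
    cardinality of [κ] if [κ] is countable. *)
Lemma supercompact_uncountable κ : supercompact_cardinal κ -> is_uncountable_cardinal κ.
Proof.
move=> sk; have ok := supercompact_ordinal sk.
have ck : is_cardinal κ := (sk κ ok).1.
split=> // cnt.
have [|γ [_ [M [j [[_ _ tM jM] [jfix _ _ kjk]]]]]] := @supercompact_embedding κ (zpow κ) sk.
  by exists κ; rewrite zpowE.
have [ν nk [[y yn _] lim]] : exists2 ν, ν ∈ κ & (exists2 y, y ∈ ν & y = y) /\
    forall y, y ∈ ν -> exists2 z, z ∈ ν & y ∈ z.
  apply/(embed_has_limit tM jM); exists κ => //; split.
    by apply/(embed_nonempty tM jM); exists κ.
  move=> y yk; apply: contrapT => nlim.
  have /(embed_bounded tM jM)/(_ _ kjk) : forall z, z ∈ κ -> z ∈ y \/ z = y.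
    move=> z zk.
    have [yz|->|] := ordinal_trichotomy (ordinal_mem ok yk) (ordinal_mem ok zk);
      [by case: nlim; exists z|by right|by left].
  rewrite jfix// => -[ky|ky]; last by apply: (@mem_irr _ κ); rewrite {2}ky.
  exact: mem_asym ky yk.
have on := ordinal_mem ok nk.
apply: (ck.2 _ nk); rewrite card_eq_le; apply/andP; split.
  by apply: subset_card_le => z; exact: ok.1 nk z.
apply: card_le_trans cnt _; apply: limit_infinite on _ lim; by exists y.
Qed.

(** In [M], the pointwise image of the family under [j] is a part of its image of
    size less than [j κ]. Hence the sets [j X], for [X] in the family, have a common
    point, from which an ultrafilter containing the family is derived. *)
Lemma supercompact_extension κ : supercompact_cardinal κ -> ultrafilter_extension κ.
Proof.
move=> sk T F FG; have ok := supercompact_ordinal sk.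
(* an enumeration needs a nonempty family *)
pose F' : set_system T := F `|` [set setT].
have [b bE] : setlike [set sub_of X | X in F'].
  by apply: (@setlike_sub _ _ (zpow T)) => _ [X _ <-]; exact: sub_of_pow.
have b0 : elts b !=set0 by rewrite bE; exists (sub_of [set: T]), [set: T] => //; right.
have [γ [f [M [j [[kg fb tM jM] [jfix cM gjk kjk]]]]]] := supercompact_embedding sk b0.
have /(embed_meet tM jM) meet : forall g, setT g -> forall ξ, ξ ∈ κ ->
    (forall η, η ∈ ξ -> exists2 x, x ∈ b & exists2 p, p ∈ g & p = opair η x) ->
    exists2 t, t ∈ T & forall η, η ∈ ξ ->
      exists2 x, x ∈ b & exists2 p, p ∈ g & p = opair η x /\ t ∈ x.
  move=> g _ ξ xk h.
  have /choice[X XP] (η : ξ) : exists X : set T, F' X /\ opair (val η) (sub_of X) ∈ g.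
    have [x + [p pg pE]] := h _ (set_valP η); rewrite bE => -[X FX Xx].
    by exists X; split=> //; rewrite Xx -pE.
  have [||t tG] := FG (range X `&` F); first by move=> ? [].
    apply: card_lt_le ok (card_lt_range X ok xk) _.
    by apply: subset_card_le => ? [].
  exists (val t); first exact: set_valP.
  move=> _ /mem_elim[η <-]; exists (sub_of (X η)).
    by rewrite bE; exists (X η) => //; exact: (XP η).1.
  exists (opair (val η) (sub_of (X η))); first exact: (XP η).2.
  split=> //; apply/sub_of_val; have [FX|->//] := (XP η).1.
  by apply: tG; split=> //; exists η.
pose g := fun_graph (fun ξ => j (f ξ)).
have gE : elts g = range (fun ξ => opair (val ξ) (j (f ξ))) by exact: fun_graphE.
have Mg : M g by apply: closed_graph => // ξ; exact: jM.1.
have [|t tT tP] := meet g Mg γ gjk.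
  move=> _ /mem_elim[η <-]; exists (j (f η)).
    by apply: (embed_mem jM _ _).1; rewrite -fb; exists η.
  by exists (opair (val η) (j (f η))) => //; rewrite gE; exists η.
exists (derived_ultrafilter j t); split; first refine (derived_ultra_complete tM jM ok jfix tT).
move=> X FX; rewrite /derived_ultrafilter /=.
have : range f (sub_of X) by rewrite fb bE; exists X => //; left.
move=> [η _ <-]; have [x _ [p]] := tP _ (set_valP η).
by rewrite gE => -[η' _ <-] [/opair_inj[/val_inj -> <-]].
Qed.

Lemma supercompact_compact κ : supercompact_cardinal κ -> compact_cardinal κ.
Proof.
move=> sk; apply: extension_compact; [exact: supercompact_uncountable|].
exact: supercompact_extension.
Qed.

End SupercompactCompact.

(** * Normal ultrafilters containing the compact cardinals *)

Section MainArgument.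
Variable Z : zfc_universe.
Implicit Types (κ : Z).

Definition compact_below κ : set κ := [set α | compact_cardinal (val α)].
Definition supercompact_below κ : set κ := [set α | supercompact_cardinal (val α)].

Lemma limit_of_cardinals_uncountable (β a : Z) : is_ordinal β -> elts β !=set0 ->
  (forall μ, μ ∈ a -> is_uncountable_cardinal μ) ->
  (forall ν, ν ∈ β -> exists2 μ, μ ∈ a & μ ∈ β /\ ν ∈ μ) -> is_uncountable_cardinal β.
Proof.
move=> ob [ν0 ν0b] ca lim; split; first split=> //.
  move=> ξ xb e; have [μ ma [mb xm]] := lim _ xb.
  apply: ((ca _ ma).1.2 _ xm); rewrite card_eq_le; apply/andP; split.
    by apply: subset_card_le => z; exact: (ordinal_mem ob mb).1 xm z.
  rewrite (card_le_eqr e); apply: subset_card_le => z; exact: ob.1 mb z.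
move=> cb; have [μ ma [mb _]] := lim _ ν0b; apply: (ca _ ma).2.
by apply: card_le_trans cb; apply: subset_card_le => z; exact: ob.1 mb z.
Qed.

Lemma measures_compact (β u a : Z) : is_ordinal β -> elts β !=set0 ->
  (forall μ, μ ∈ a -> compact_cardinal μ) ->
  measures setT β u a -> compact_cardinal β.
Proof.
move=> ob b0 ca [m1 [m2 [m3 m4]]].
have ub : is_uncountable_cardinal β.
  by apply: (limit_of_cardinals_uncountable (a := a)) => // μ /ca[].
pose W : set_system β := [set X | sub_of X ∈ u].
apply: (@measurable_limit_compact _ _ W) => //.
- split=> [X|ξ X Y xb WX XY].
    apply: m1 => //; [exact: sub_of_sub|exact: sub_of_sub|].
    by move=> _ /mem_elim[z <-]; rewrite !sub_of_val.
  apply: (m2 (family_graph X) _ (sub_of Y) _ _ ξ xb) => //; first exact: sub_of_sub.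
    move=> _ /mem_elim[η <-]; exists (sub_of (X η)); first exact: WX.
    by move=> z; exact: family_graph_fiber.
  by move=> _ /mem_elim[z <-] /family_graph_meet Xz; exact/sub_of_val/XY.
- move=> ν Wν; apply: m3 (set_valP ν) _ Wν _ => z.
  by rewrite sub_ofE => -[_ -> <-].
- move=> ξ /m4[μ ma [mb xm]]; by exists μ => //; split=> //; exact: ca.
Qed.

(** The ultrafilter [U] derived from an embedding into a class [M] closed under
    sequences of length 2^κ belongs to [M]. There it witnesses that
    [κ] is a measurable limit of compact cardinals below [κ], so that [U]
    concentrates on such limits, which are compact. *)
Lemma supercompact_normal κ : supercompact_cardinal κ ->
  (forall ξ, ξ ∈ κ -> exists2 μ, ξ ∈ μ & μ ∈ κ /\ compact_cardinal μ) ->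
  exists U : set_system κ, normal_ultrafilter U /\ U (@compact_below κ).
Proof.
move=> sk lim; have ok := supercompact_ordinal sk.
have uk := supercompact_uncountable sk.
have [|γ [f [M [j [[kg fb tM jM] [jfix cM gjk kjk]]]]]] :=
  supercompact_embedding (b := zpow κ) sk.
  by exists κ; rewrite zpowE.
have nU := derived_normal tM jM uk jfix kjk.
have [uU Un] := (complete_ultrafilterP _ uk).1 nU.1.
set U := derived_ultrafilter _ _ in nU uU Un.
exists U; split=> //; have k2 := uncountable_cardinal_pair uk.
pose a := sub_of (@compact_below κ).
pose s := sub_of [set β : κ | exists u, measures setT (val β) u a].
(* it says that [s], the set of measurable limits of [a], is in [U] *)
suff Us : κ ∈ j s.
  have k0 := ultra_complete_final ok k2 uU Un.
  have [ξ [xk _]] := k2.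
  apply: (ultra_complete_sub k2 uU) (ultra_completeI k2 uU (Us : U _) (k0 ξ xk)).
  move=> β [[u mu] xb]; apply: measures_compact mu.
  - exact: ordinal_mem ok (set_valP β).
  - by exists ξ.
  - by move=> μ; rewrite /a sub_ofE => -[α ? <-].
have Mk z : z ∈ κ -> M z by move=> zk; rewrite -(jfix z zk); exact: jM.1.
have Msub x : elts x `<=` elts κ -> elts x !=set0 -> M x.
  move=> xk [x0 x0x].
  apply: (@closed_range _ M j tM jM γ
    (fun ξ => if pselect (val ξ ∈ x) then val ξ else x0)) => //.
    by move=> ξ; case: pselect => h; apply: Mk; exact: xk.
  apply/seteqP; split=> [z zx|_ [ξ _ <-]]; last by case: pselect.
  by exists (mem_of (kg _ (xk _ zx))) => //=; case: pselect.
have [û uE] : setlike [set sub_of X | X in U].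
  by apply: (@setlike_sub _ _ (zpow κ)) => _ [X _ <-]; exact: sub_of_pow.
have ûP (X : set κ) : sub_of X ∈ û <-> U X.
  rewrite uE; split=> [[Y UY YX]|UX]; last by exists X.
  suff -> : X = Y by [].
  by apply/seteqP; split=> z; rewrite -!sub_of_val YX.
have ûsub x : x ∈ û -> exists2 X, U X & x = sub_of X by rewrite uE => -[X UX <-]; exists X.
have subE x : elts x `<=` elts κ -> x = sub_of [set z : κ | val z ∈ x].
  move=> xk; apply: zfc_extensionality; rewrite sub_ofE; apply/seteqP; split=> z.
    by move=> zx; exists (mem_of (xk _ zx)).
  by move=> [z' ? <-].
have Mû : M û.
  have UT := (ûP _).2 (ultra_completeT k2 uU).
  apply: (@closed_range _ M j tM jM γ
    (fun ξ => if pselect (f ξ ∈ û) then f ξ else sub_of [set: κ])) => //.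
    move=> ξ; have : (if pselect (f ξ ∈ û) then f ξ else sub_of [set: κ]) ∈ û.
      by case: pselect.
    move=> /ûsub[X UX ->]; apply: Msub; first exact: sub_of_sub.
    have [z Xz] := ultra_complete_nonempty k2 uU UX.
    by exists (val z); exact/sub_of_val.
  apply/seteqP; split=> [x xu|_ [ξ _ <-]]; last by case: pselect.
  have [X UX xX] := ûsub _ xu.
  have : range f x by rewrite fb xX; exact: sub_of_pow.
  by move=> [ξ _ fx]; exists ξ => //; case: pselect; rewrite fx.
have /(embed_measures tM jM)/(_ _ kjk) : forall β, β ∈ κ ->
    (exists2 u, setT u & measures setT β u a) -> β ∈ s.
  by move=> _ /mem_elim[β <-] [u _ mu]; apply/sub_of_val; exists u.
apply; exists û => //; split; [|split; [|split]].
- move=> x _ y _ xk yk xy.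
  rewrite (subE x xk) (subE y yk) !ûP -(ultra_completeC uU).
  suff -> : ~` [set z : κ | val z ∈ y] = [set z : κ | val z ∈ x] by [].
  by apply/seteqP; split=> z /=; have := xy _ (set_valP z); tauto.
- move=> g _ w _ wk ξ xk hx hw; rewrite (subE w wk); apply/ûP.
  have /choice[X XP] (η : ξ) : exists X : set κ, U X /\
      forall z, X z -> opair (val η) (val z) ∈ g.
    have [x /ûsub[X UX ->] h] := hx _ (set_valP η).
    exists X; split=> // z Xz; have [|p pg <-//] := h (val z).
    exact/sub_of_val.
  apply: (uU.2 ξ X) => // [η|z Xz]; first exact: (XP η).1.
  apply: hw; first exact: set_valP.
  by move=> _ /mem_elim[η <-]; exists (opair (val η) (val z)) => //; exact: (XP η).2.
- move=> _ /mem_elim[ν <-] _ /ûsub[X UX ->] h; apply: (Un ν).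
  apply: (ultra_complete_sub k2 uU) UX => z Xz; apply: val_inj; apply: h.
  exact/sub_of_val.
- move=> ν /lim[μ nm [mk mc]]; exists μ => //.
  rewrite -(jfix μ mk); apply: (embed_mem jM _ _).1.
  by rewrite /a sub_ofE; exists (mem_of mk).
Qed.

Definition trace κ (α : κ) (X : set κ) : set (val α) :=
  [set ν | exists2 ν' : κ, X ν' & val ν' = val ν].
Arguments trace {κ} α X _ : rename.

(** A function that is regressive on a set in the average is, for almost every [α],
    constant on a set in [U α]; the constant value is a regressive function of [α],
    hence is itself constant almost everywhere. *)
Lemma normal_average κ (W : set_system κ) (U : forall α : κ, set_system (val α)) :
  is_uncountable_cardinal κ -> normal_ultrafilter W ->
  W [set α | is_uncountable_cardinal (val α) /\ normal_ultrafilter (U α)] ->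
  normal_ultrafilter [set X | W [set α | U α (trace α X)]].
Proof.
move=> uk nW WU; have ok : is_ordinal κ := uk.1.1.
have k2 := uncountable_cardinal_pair uk.
have [uW Wn] := (complete_ultrafilterP _ uk).1 nW.1.
have sub (α : κ) (ν : val α) : val ν ∈ κ by exact: ok.1 (set_valP α) _ (set_valP ν).
have traceE (α : κ) X (ν : val α) : trace α X ν <-> X (mem_of (sub α ν)).
  split=> [[ν' Xν' e]|Xν]; last by exists (mem_of (sub α ν)).
  by rewrite (_ : mem_of _ = ν')//; exact: val_inj.
have fin := ultra_complete_final ok k2 uW Wn.
have uUt (α : κ) : is_uncountable_cardinal (val α) -> normal_ultrafilter (U α) ->
    ultra_complete (val α) [set X : set κ | U α (trace α X)].
  move=> ua nU; have [uU _] := (complete_ultrafilterP _ ua).1 nU.1.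
  split=> [X|ξ X Y xa UX XY] /=.
    rewrite -(ultra_completeC uU); suff -> : trace α (~` X) = ~` trace α X by [].
    by apply/seteqP; split=> ν /=; rewrite !traceE.
  apply: (uU.2 ξ (fun η => trace α (X η))) => // ν h.
  by apply/traceE/XY => η; apply/traceE.
have uavg : ultra_complete κ [set X | W [set α | U α (trace α X)]].
  apply: (ultra_complete_average (c := fun α : κ => val α)
    (U := fun α => [set X | U α (trace α X)]) k2 uW) => //.
  by apply: (ultra_complete_sub k2 uW) WU => α [ua nU]; exact: uUt.
split.
  apply/(complete_ultrafilterP _ uk); split=> // ν /= Wν.
  have := ultra_completeI k2 uW WU (ultra_completeI k2 uW Wν (fin _ (set_valP ν))).
  move=> /(ultra_complete_nonempty k2 uW)[α [[ua nU] [/= Uν na]]].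
  have [_ Un] := (complete_ultrafilterP _ ua).1 nU.1; apply: (Un (mem_of na)).
  suff -> : [set mem_of na] = trace α [set ν] by [].
  apply/seteqP; split=> x; first by move=> ->; exists ν.
  by move=> [_ -> e]; exact: val_inj.
move=> X f UX freg.
(* the constant value of [f] below [α], a member of [α] *)
have /choice[g gP] (α : κ) : exists β : κ,
    [/\ is_uncountable_cardinal (val α), normal_ultrafilter (U α) & U α (trace α X)] ->
    val β ∈ val α /\ U α (trace α [set ν | X ν /\ f ν = β]).
  have [[ua nU UXα]|?] := pselect ([/\ is_uncountable_cardinal (val α),
    normal_ultrafilter (U α) & U α (trace α X)]); last by exists α.
  have a2 := uncountable_cardinal_pair ua.
  have [uU _] := (complete_ultrafilterP _ ua).1 nU.1.
  have [ν0 _] := ultra_complete_nonempty a2 uU (ultra_completeT a2 uU).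
  pose fα (ν : val α) : val α :=
    if pselect (val (f (mem_of (sub α ν))) ∈ val α) is left h then mem_of h else ν0.
  have fαE (ν : val α) : trace α X ν -> val (fα ν) = val (f (mem_of (sub α ν))).
    move=> /traceE /freg /= h; rewrite /fα; case: pselect => // nh; case: nh.
    exact: (ordinal_mem ok (set_valP α)).1 (set_valP ν) _ h.
  have [ν /[dup] Xν /traceE/freg h|Y UY [YX [β Yβ]]] := nU.2 _ fα UXα.
    by rewrite fαE.
  exists (mem_of (sub α β)) => _; split; first exact: (set_valP β).
  apply: (ultra_complete_sub a2 uU) UY => ν Yν; apply/traceE; split.
    exact/traceE/YX.
  by apply: val_inj; rewrite /= -fαE ?Yβ//; exact: YX.
have := ultra_completeI k2 uW WU UX.
move=> /[dup] WA /nW.2 h; have {h} [α [[ua nU] UXα]|B WB [BA [β gβ]]] := h g.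
  by have [] := gP α (And3 ua nU UXα).
exists [set ν | X ν /\ f ν = β].
  apply: (ultra_complete_sub k2 uW) WB => α Bα; have [[ua nU] UXα] := BA _ Bα.
  by have [_] := gP α (And3 ua nU UXα); rewrite gβ.
by split=> [ν []//|]; exists β => ν [].
Qed.

(** Induction on [κ], through the supercompact cardinals below [κ], replaces the
    choice of a minimal normal ultrafilter in the Mitchell order: the average built
    here lies below [V] in that order. *)
Lemma normal_avoiding_supercompact κ : is_uncountable_cardinal κ ->
  (exists2 V : set_system κ, normal_ultrafilter V & V (@compact_below κ)) ->
  exists W : set_system κ, [/\ normal_ultrafilter W, W (@compact_below κ) &
    ~ W (@supercompact_below κ)].
Proof.
elim/mem_ind: κ => κ IH uk [V nV VA1].
have ok : is_ordinal κ := uk.1.1; have k2 := uncountable_cardinal_pair uk.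
have [uV Vn] := (complete_ultrafilterP _ uk).1 nV.1.
have fin := ultra_complete_final ok k2 uV Vn.
have [VA2|] := pselect (V (@supercompact_below κ)); last by exists V.
pose L := [set α : κ | forall ξ, ξ ∈ val α ->
  exists2 μ, ξ ∈ μ & μ ∈ val α /\ compact_cardinal μ].
have VL : V L.
  (* otherwise a bound [g α] of the compact cardinals below [α] would be constant
     almost everywhere, although the compact cardinals are unbounded in [κ] *)
  apply: contrapT => /(ultra_completeC uV) VnL.
  have /choice[g gP] (α : κ) : exists β : κ, ~ L α ->
      val β ∈ val α /\ forall μ, val β ∈ μ -> μ ∈ val α -> ~ compact_cardinal μ.
    have [?|/existsNP[ξ /not_implyP[xa h]]] := pselect (L α); first by exists α.
    have xk : ξ ∈ κ by exact: ok.1 (set_valP α) _ xa.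
    by exists (mem_of xk) => _; split=> // μ xm ma mc; apply: h; exists μ.
  have [α nL|B VB [BL [β gβ]]] := nV.2 _ g VnL; first by have [] := gP α nL.
  have [μ [mc bm]] := ultra_complete_nonempty k2 uV
    (ultra_completeI k2 uV VA1 (fin _ (set_valP β))).
  have [α [Bα ma]] := ultra_complete_nonempty k2 uV
    (ultra_completeI k2 uV VB (fin _ (set_valP μ))).
  by have [_ /(_ (val μ))] := gP α (BL _ Bα); rewrite (gβ _ Bα); apply.
pose good (α : κ) := supercompact_cardinal (val α) /\ L α.
have Wex (α : κ) : exists W : set_system (val α), good α ->
    [/\ normal_ultrafilter W, W (@compact_below (val α)) & ~ W (@supercompact_below (val α))].
  have [[sα Lα]|?] := pselect (good α); last by exists set0.
  have [U [nU UA1]] := supercompact_normal sα Lα.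
  have [|W HW] := IH _ (set_valP α) (supercompact_uncountable sα); first by exists U.
  by exists W.
have [U UP] : exists U : forall α : κ, set_system (val α), forall α, good α ->
    [/\ normal_ultrafilter (U α), U α (@compact_below (val α)) &
      ~ U α (@supercompact_below (val α))].
  by exists (fun α => projT1 (cid (Wex α))) => α; exact: projT2 (cid (Wex α)).
have Vgood : V good by exact: (ultra_completeI k2 uV VA2 VL).
exists [set X | V [set α | U α (trace α X)]]; split.
- apply: (normal_average uk nV); apply: (ultra_complete_sub k2 uV) Vgood => α gα.
  by have [? _ _] := UP α gα; split=> //; exact: supercompact_uncountable gα.1.
- apply: (ultra_complete_sub k2 uV) Vgood => α gα /=; have [_ + _] := UP α gα.
  suff -> : trace α (@compact_below κ) = @compact_below (val α) by [].
  apply/seteqP; split=> ν; first by move=> [ν' + e]; rewrite /compact_below /= e.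
  by move=> cν; exists (mem_of (ok.1 _ (set_valP α) _ (set_valP ν))).
- move=> VU; have [α [gα Uα]] := ultra_complete_nonempty k2 uV (ultra_completeI k2 uV Vgood VU).
  have [_ _] := UP α gα; apply.
  suff <- : trace α (@supercompact_below κ) = @supercompact_below (val α) by [].
  apply/seteqP; split=> ν; first by move=> [ν' + e]; rewrite /supercompact_below /= e.
  by move=> cν; exists (mem_of (ok.1 _ (set_valP α) _ (set_valP ν))).
Qed.

End MainArgument.

Theorem theorem1p4 (Z : zfc_universe) (κ : Z)
    (A1 := [set α : κ | compact_cardinal (val α)])
    (A2 := [set α : κ | supercompact_cardinal (val α)])
    (V : set_system κ) :
  measurable_cardinal κ -> normal_ultrafilter V -> V A2 ->
  exists W : set_system κ,
    [/\ normal_ultrafilter W, W <> V, W A1 & ~ W A2].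
Proof.
move=> [uk _] nV VA2; have k2 := uncountable_cardinal_pair uk.
have [uV _] := (complete_ultrafilterP _ uk).1 nV.1.
have VA1 : V A1.
  by apply: (ultra_complete_sub k2 uV) VA2 => α; exact: supercompact_compact.
have [|W [nW WA1 WA2]] := @normal_avoiding_supercompact Z κ uk; first by exists V.
by exists W; split=> // WV; apply: WA2; rewrite WV.
Qed.
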